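(* Let $\mathcal{H}$ be a separable complex Hilbert space, let $T\in B(\mathcal{H})$ be self-adjoint, and let $\varphi\in\mathcal{H}$ be such that the sequence $\{T^{k}\varphi\}_{k=0}^{\infty}$ is a frame for $\mathcal{H}$. Let $\mu_{\varphi}$ be the positive Borel measure on $\sigma(T)$ associated with $T$ and $\varphi$ (the spectral measure of $T$ at $\varphi$). Then there exists a unitary operator $V:\mathcal{H}\to L^{2}(\sigma(T),\mu_{\varphi})$ such that for all $f\in L^{2}(\sigma(T),\mu_{\varphi})$, $$(VTV^{*}f)(x)=xf(x)$$ (as elements of $L^2(\sigma(T),\mu_\varphi)$, i.e. for $\mu_\varphi$-almost every $x\in\sigma(T)$).
   Context: $B(\mathcal{H})$ denotes the bounded linear operators on $\mathcal{H}$ and $\sigma(T)$ the spectrum of $T$. Inner products are linear in the first variable. A sequence $\{f_k\}$ in $\mathcal{H}$ is a frame for $\mathcal{H}$ if there are constants $A,B>0$ with $A\|f\|^2\le\sum_k|\langle f,f_k\rangle|^2\le B\|f\|^2$ for all $f\in\mathcal{H}$. For self-adjoint $T\in B(\mathcal{H})$ and $\varphi\in\mathcal{H}$, $\mu_\varphi$ is the unique positive (regular) Borel measure on $\sigma(T)$ given by the Riesz representation theorem such that $\langle f(T)\varphi,\varphi\rangle=\int_{\sigma(T)}f(\lambda)\,d\mu_\varphi(\lambda)$ for every continuous $f:\sigma(T)\to\mathbb{C}$, where $f(T)$ is defined by the continuous functional calculus; in particular $\mu_\varphi(\sigma(T))=\|\varphi\|^2$. *)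

(* Defs.v *)
From HB Require Import structures.
From mathcomp Require Import all_boot all_order all_algebra.
From mathcomp Require Import all_classical all_reals all_analysis.
From mathcomp Require Import measurable_realfun complex lra.

Set Implicit Arguments.
Unset Strict Implicit.
Unset Printing Implicit Defensive.

Import Order.TTheory GRing.Theory Num.Theory numFieldNormedType.Exports.

Local Open Scope classical_set_scope.
Local Open Scope ring_scope.
Local Open Scope complex_scope.

(* [R[i]^o] is [R[i]] seen as a normed module over itself; this is where the
   library puts the topology of the complex plane. *)
Notation Cplx R := (R[i]^o) (only parsing).

(* The norm of a normed module over [R[i]] takes its values in [R[i]]. *)
Definition rnorm (R : realType) (V : normedZmodType R[i]) (x : V) : R :=
  complex.Re `|x|.

HB.mixin Record CompleteNormedModule_isHilbert (R : realType) H
    & CompleteNormedModule R[i] H := {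
  dotp : {dot H for @conjc R} ;
  dotp_norm : forall x : H, dotp x x = `|x| ^+ 2
}.

#[short(type="hilbertType")]
HB.structure Definition Hilbert (R : realType) :=
  {H of CompleteNormedModule R[i] H & CompleteNormedModule_isHilbert R H}.

Section operators.
Context (R : realType).

Definition separable (T : topologicalType) :=
  exists D : set T, countable D /\ dense D.

Definition bounded_op (U V : normedZmodType R[i]) (A : U -> V) :=
  exists M : R, forall x, rnorm (A x) <= M * rnorm x.

Definition adjoint (U V : lmodType R[i]) (dU : {dot U for @conjc R})
    (dV : {dot V for @conjc R}) (A : U -> V) (B : V -> U) :=
  forall x y, dV (A x) y = dU x (B y).

Definition unitary (U V : lmodType R[i]) (dU : {dot U for @conjc R})
    (dV : {dot V for @conjc R}) (A : {linear U -> V}) :=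
  isometry dV dU A /\ bijective A.

Context (H : hilbertType R).

Definition self_adjoint (T : H -> H) := adjoint dotp dotp T T.

Definition frame (u : nat -> H) :=
  exists A B : R, [/\ 0 < A, 0 < B & forall f : H,
    ((A * rnorm f ^+ 2)%:E <=
       \sum_(0 <= k <oo) (rnorm (dotp f (u k)) ^+ 2)%:E <=
     (B * rnorm f ^+ 2)%:E)%E].

Definition spectrum (T : H -> H) : set (Cplx R) :=
  [set l | ~ exists S : {linear H -> H}, [/\ bounded_op S,
     cancel (fun x => T x - l *: x) S & cancel S (fun x => T x - l *: x)]].

Definition poly_op (T : H -> H) (p : {poly R[i]}) (x : H) : H :=
  \sum_(i < size p) p`_i *: iter i T x.

Definition op_cvg (A_ : nat -> H -> H) (A : H -> H) :=
  forall e : R, 0 < e ->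
    \forall n \near \oo, forall x, rnorm (A_ n x - A x) <= e * rnorm x.

(* [A = f(T)] in the continuous functional calculus of the self-adjoint
   operator [T]: [A] is the norm limit of [p_n(T)] for polynomials [p_n]
   converging to [f] uniformly on the spectrum. *)
Definition continuous_calculus (T : H -> H) (f : Cplx R -> Cplx R)
    (A : H -> H) :=
  exists p : nat -> {poly R[i]},
    {uniform spectrum T,
      (fun n (x : Cplx R) => (p n).[x] : Cplx R) @ \oo --> f} /\
    op_cvg (fun n => poly_op T (p n)) A.

End operators.

Definition borelC (R : realType) := g_sigma_algebraType (@open (Cplx R)).
HB.instance Definition _ (R : realType) := Measurable.on (borelC R).

Section cintegral.
Context d (X : measurableType d) (R : realType).
Variable mu : {measure set X -> \bar R}.

Definition cintegral (D : set X) (f : X -> R[i]) : R[i] :=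
  (\int[mu]_(x in D) complex.Re (f x)) +i* (\int[mu]_(x in D) complex.Im (f x)).

End cintegral.

Section L2.
Context d (X : measurableType d) (R : realType).
Variable mu : {measure set X -> \bar R}.
Implicit Types (f g : X -> R[i]) (a : R[i]).

Definition cmeasurable f :=
  measurable_fun setT (fun x => complex.Re (f x)) /\
  measurable_fun setT (fun x => complex.Im (f x)).

Definition cintegrable f :=
  mu.-integrable setT (fun x => (complex.Re (f x))%:E) /\
  mu.-integrable setT (fun x => (complex.Im (f x))%:E).

Definition sqint : {pred X -> R[i]} :=
  [pred f | `[< cmeasurable f /\
                (\int[mu]_x (rnorm (f x) ^+ 2)%:E < +oo)%E >]].

Lemma rnorm2E (z : R[i]) :
  rnorm z ^+ 2 = complex.Re z ^+ 2 + complex.Im z ^+ 2.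
Proof.
by rewrite /rnorm normc_def/= sqr_sqrtr// addr_ge0// sqr_ge0.
Qed.

Lemma Re_add (z w : R[i]) : complex.Re (z + w) = complex.Re z + complex.Re w.
Proof. by case: z w => [? ?] [? ?]. Qed.
Lemma Im_add (z w : R[i]) : complex.Im (z + w) = complex.Im z + complex.Im w.
Proof. by case: z w => [? ?] [? ?]. Qed.
Lemma Re_mul (z w : R[i]) : complex.Re (z * w) =
  complex.Re z * complex.Re w - complex.Im z * complex.Im w.
Proof. by case: z w => [? ?] [? ?]. Qed.
Lemma Im_mul (z w : R[i]) : complex.Im (z * w) =
  complex.Re z * complex.Im w + complex.Im z * complex.Re w.
Proof. by case: z w => [? ?] [? ?]. Qed.
Lemma Re_conj (z : R[i]) : complex.Re z^* = complex.Re z.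
Proof. by case: z. Qed.
Lemma Im_conj (z : R[i]) : complex.Im z^* = - complex.Im z.
Proof. by case: z. Qed.

Lemma cmeasurableD f g : cmeasurable f -> cmeasurable g ->
  cmeasurable (fun x => f x + g x).
Proof.
move=> [f1 f2] [g1 g2]; split.
  by under eq_fun do rewrite Re_add; exact: measurable_funD.
by under eq_fun do rewrite Im_add; exact: measurable_funD.
Qed.

Lemma cmeasurableM f g : cmeasurable f -> cmeasurable g ->
  cmeasurable (fun x => f x * g x).
Proof.
move=> [f1 f2] [g1 g2]; split.
  by under eq_fun do rewrite Re_mul; apply: measurable_funB; exact: measurable_funM.
by under eq_fun do rewrite Im_mul; apply: measurable_funD; exact: measurable_funM.
Qed.

Lemma cmeasurableJ f : cmeasurable f -> cmeasurable (fun x => (f x)^*).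
Proof.
move=> [f1 f2]; split; first by under eq_fun do rewrite Re_conj.
by under eq_fun do rewrite Im_conj; exact: measurableT_comp.
Qed.

Lemma cmeasurable_cst a : cmeasurable (fun=> a).
Proof. by split; exact: measurable_cst. Qed.

Lemma measurable_rnorm2 f : cmeasurable f ->
  measurable_fun setT (fun x => rnorm (f x) ^+ 2).
Proof.
move=> [f1 f2]; under eq_fun do rewrite rnorm2E.
by apply: measurable_funD; exact: measurable_funX.
Qed.

Lemma sqintP f : reflect (cmeasurable f /\
    mu.-integrable setT (fun x => (rnorm (f x) ^+ 2)%:E)) (f \in sqint).
Proof.
apply: (iffP idP) => [/asboolP[mf oof]|[mf /integrableP[_ oof]]].
  split=> //; apply/integrableP; split.
    by apply/measurable_EFinP; exact: measurable_rnorm2.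
  by under eq_integral do rewrite gee0_abs ?lee_fin ?sqr_ge0//.
apply/asboolP; split => //.
by under eq_integral do rewrite -[(_)%:E]gee0_abs ?lee_fin ?sqr_ge0//.
Qed.

Lemma integrable_dom (h k : X -> R) : measurable_fun setT h ->
  (forall x, `|h x| <= k x) -> mu.-integrable setT (EFin \o k) ->
  mu.-integrable setT (EFin \o h).
Proof.
move=> mh hk; apply: le_integrable => //; first exact/measurable_EFinP.
by move=> x _ /=; rewrite lee_fin (le_trans (hk x))// ler_norm.
Qed.

Lemma integrable_cmul f g : f \in sqint -> g \in sqint ->
  cintegrable (fun x => f x * (g x)^*).
Proof.
move=> /sqintP[mf If] /sqintP[mg Ig].
have IS : mu.-integrable setT
   (EFin \o (fun x => rnorm (f x) ^+ 2 + rnorm (g x) ^+ 2)).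
  exact: (integrableD _ If Ig).
have [m1 m2] := cmeasurableM mf (cmeasurableJ mg).
have le (a b c e : R) : `|a * c + b * e| <= a ^+ 2 + b ^+ 2 + (c ^+ 2 + e ^+ 2).
  have := sqr_ge0 (a + c); have := sqr_ge0 (a - c).
  have := sqr_ge0 (b + e); have := sqr_ge0 (b - e).
  have := sqr_ge0 a; have := sqr_ge0 b; have := sqr_ge0 c; have := sqr_ge0 e.
  by rewrite ler_norml !expr2 => *; apply/andP; split; lra.
split; apply: integrable_dom IS => // x.
  by rewrite Re_mul Re_conj Im_conj !rnorm2E mulrN opprK le.
rewrite Im_mul Re_conj Im_conj !rnorm2E mulrN -mulNr (le_trans (le _ _ _ _))//.
by rewrite sqrrN lerD2l addrC.
Qed.

Lemma sqint_submod_closed : submod_closed sqint.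
Proof.
split.
  apply/sqintP; split; first exact: (cmeasurable_cst 0).
  rewrite (_ : (fun x => _) = cst 0%E); first exact: integrable0.
  by apply/funext => x /=; rewrite rnorm2E/= expr0n addr0.
move=> a f g /sqintP[mf If] /sqintP[mg Ig]; apply/sqintP.
have m : cmeasurable (a *: f + g).
  by apply: cmeasurableD => //; exact: (cmeasurableM (cmeasurable_cst a)).
split=> //.
have IS : mu.-integrable setT (EFin \o (fun x =>
    (2 * rnorm a ^+ 2) * rnorm (f x) ^+ 2 + 2 * rnorm (g x) ^+ 2)).
  exact: (integrableD _ (integrableZl _ _ If) (integrableZl _ _ Ig)).
apply: integrable_dom IS; first exact: measurable_rnorm2.
move=> x; rewrite ger0_norm ?sqr_ge0//.
have -> : (a *: f + g) x = a * f x + g x by [].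
rewrite !rnorm2E Re_add Im_add Re_mul Im_mul.
set p := complex.Re a; set q := complex.Im a.
set r := complex.Re (f x); set s := complex.Im (f x).
set t := complex.Re (g x); set u := complex.Im (g x).
have := sqr_ge0 (p * r - q * s - t); have := sqr_ge0 (p * s + q * r - u).
rewrite !expr2; nra.
Qed.

HB.instance Definition _ := GRing.isSubmodClosed.Build _ _ sqint
  sqint_submod_closed.

Record sqfun := Sqfun { sqfun_val :> X -> R[i] ; _ : sqfun_val \in sqint }.

HB.instance Definition _ := [isSub for sqfun_val].
HB.instance Definition _ := [Choice of sqfun by <:].
HB.instance Definition _ := [SubChoice_isSubLmodule of sqfun by <:].

Definition ae_null : {pred sqfun} :=
  [pred f : sqfun | `[< {ae mu, forall x, f x = 0} >]].

Lemma ae_null_zmod_closed : zmod_closed ae_null.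
Proof.
split; first by apply/asboolP; apply: aeW.
move=> f g /asboolP f0 /asboolP g0; apply/asboolP.
apply: filterS2 f0 g0 => x fx gx.
by have -> : (f - g) x = f x - g x by []; rewrite fx gx subr0.
Qed.

HB.instance Definition _ := GRing.isZmodClosed.Build _ ae_null
  ae_null_zmod_closed.

Local Open Scope quotient_scope.

Definition L2 := Quotient.quot ae_null.
HB.instance Definition _ := GRing.Zmodule.on L2.
HB.instance Definition _ := EqQuotient.on L2.

(* A representative of the class [u], well defined up to a null set. *)
Definition L2_fun (u : L2) : X -> R[i] := repr u.

Lemma pi_ae (f g : sqfun) :
  \pi_L2 f = \pi_L2 g <-> {ae mu, forall x, f x = g x}.
Proof.
have E : (\pi_L2 f == \pi_L2 g) = (f - g \in ae_null).
  by rewrite Quotient.idealrBE.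
split=> [/eqP|fg].
  rewrite E => /asboolP; apply: filterS => x.
  by have -> : (f - g) x = f x - g x by []; move/eqP; rewrite subr_eq0 => /eqP.
apply/eqP; rewrite E; apply/asboolP; apply: filterS fg => x fg.
by have -> : (f - g) x = f x - g x by []; rewrite fg subrr.
Qed.

Lemma L2_fun_pi (f : sqfun) : {ae mu, forall x, L2_fun (\pi_L2 f) x = f x}.
Proof. by apply/pi_ae; rewrite reprK. Qed.

Definition L2_scale a (u : L2) : L2 := \pi_L2 (a *: repr u).

Lemma L2_scale_pi a (f : sqfun) : L2_scale a (\pi_L2 f) = \pi_L2 (a *: f).
Proof.
apply/pi_ae; apply: filterS (L2_fun_pi f) => x fx.
by have E (g : sqfun) : (a *: g) x = a * g x by []; rewrite !E -fx.
Qed.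

Lemma L2_ind (P : L2 -> Prop) : (forall f : sqfun, P (\pi_L2 f)) -> forall u, P u.
Proof. by move=> Pf u; rewrite -[u]reprK. Qed.

Lemma L2_scaleA a b u : L2_scale a (L2_scale b u) = L2_scale (a * b) u.
Proof. by elim/L2_ind: u => f; rewrite !L2_scale_pi scalerA. Qed.

Lemma L2_scale1 : left_id 1 L2_scale.
Proof. by elim/L2_ind => f; rewrite L2_scale_pi scale1r. Qed.

Lemma L2_piD (f g : sqfun) : \pi_L2 (f + g) = \pi_L2 f + \pi_L2 g.
Proof. exact: Quotient.pi_add. Qed.

Lemma L2_pi0 : \pi_L2 0 = 0.
Proof. by apply: (addIr (\pi_L2 0)); rewrite add0r -L2_piD addr0. Qed.

Lemma L2_scaleDr : right_distributive L2_scale +%R.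
Proof.
move=> a; elim/L2_ind => f; elim/L2_ind => g.
by rewrite -L2_piD !L2_scale_pi scalerDr L2_piD.
Qed.

Lemma L2_scaleDl u : {morph L2_scale^~ u : a b / a + b}.
Proof.
by move=> a b; elim/L2_ind: u => f; rewrite !L2_scale_pi scalerDl L2_piD.
Qed.

HB.instance Definition _ := GRing.Zmodule_isLmodule.Build R[i] L2
  L2_scaleA L2_scale1 L2_scaleDr L2_scaleDl.

Lemma sqfunP (f : sqfun) : sqfun_val f \in sqint.
Proof. exact: valP. Qed.

Lemma cintegral_ae f g : cmeasurable f -> cmeasurable g ->
  {ae mu, forall x, f x = g x} -> cintegral mu setT f = cintegral mu setT g.
Proof.
move=> [f1 f2] [g1 g2] fg; rewrite /cintegral /Rintegral.
congr (fine _ +i* fine _); apply: ae_eq_integral => //.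
- exact/measurable_EFinP.
- exact/measurable_EFinP.
- by apply: filterS fg => x /= -> _.
- exact/measurable_EFinP.
- exact/measurable_EFinP.
- by apply: filterS fg => x /= -> _.
Qed.

Lemma cintegralD f g : cintegrable f -> cintegrable g ->
  cintegral mu setT (fun x => f x + g x) =
  cintegral mu setT f + cintegral mu setT g.
Proof.
move=> [f1 f2] [g1 g2]; rewrite /cintegral; congr (_ +i* _).
  by under eq_Rintegral do rewrite Re_add; rewrite RintegralD.
by under eq_Rintegral do rewrite Im_add; rewrite RintegralD.
Qed.

Lemma cintegralZ a f : cintegrable f ->
  cintegral mu setT (fun x => a * f x) = a * cintegral mu setT f.
Proof.
move=> [f1 f2]; rewrite /cintegral; case: a => p q.
have Z (r : R) h : mu.-integrable setT (EFin \o h) ->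
    mu.-integrable setT (EFin \o (fun x => r * h x)).
  exact: integrableZl.
congr (_ +i* _).
  under eq_Rintegral do rewrite Re_mul.
  by rewrite RintegralB/= ?RintegralZl//; exact: Z.
under eq_Rintegral do rewrite Im_mul.
by rewrite RintegralD/= ?RintegralZl//; exact: Z.
Qed.

Lemma cintegralJ f :
  cintegrable f ->
  cintegral mu setT (fun x => (f x)^*) = (cintegral mu setT f)^*.
Proof.
move=> [f1 f2]; rewrite /cintegral/=; congr (_ +i* _).
  by under eq_Rintegral do rewrite Re_conj.
under eq_Rintegral do rewrite Im_conj -mulN1r.
by rewrite RintegralZl// mulN1r.
Qed.

Definition L2_dot (u v : L2) : R[i] :=
  cintegral mu setT (fun x => L2_fun u x * (L2_fun v x)^*).

Lemma L2_dot_pi (f g : sqfun) : L2_dot (\pi_L2 f) (\pi_L2 g) =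
  cintegral mu setT (fun x => f x * (g x)^*).
Proof.
have m (h : sqfun) : cmeasurable h by have /sqintP[] := sqfunP h.
have mM (h k : sqfun) : cmeasurable (fun x => h x * (k x)^*).
  by apply: cmeasurableM => //; exact: cmeasurableJ.
apply: cintegral_ae => //; first exact: (mM (repr _) (repr _)).
by apply: filterS2 (L2_fun_pi f) (L2_fun_pi g) => x -> ->.
Qed.

Lemma L2_dotJ u v : L2_dot u v = (L2_dot v u)^*.
Proof.
elim/L2_ind: u => f; elim/L2_ind: v => g; rewrite !L2_dot_pi.
rewrite -cintegralJ; last by apply: integrable_cmul; exact: sqfunP.
by congr cintegral; apply/funext => x; rewrite rmorphM/= conjcK mulrC.
Qed.

Lemma L2_dotPl a u v w : L2_dot (a *: u + v) w = a * L2_dot u w + L2_dot v w.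
Proof.
elim/L2_ind: u => f; elim/L2_ind: v => g; elim/L2_ind: w => h.
have -> : a *: (\pi_L2 f : L2) = \pi_L2 (a *: f) by exact: L2_scale_pi.
rewrite -L2_piD !L2_dot_pi.
have I (k : sqfun) : cintegrable (fun x => k x * (h x)^*).
  by apply: integrable_cmul; exact: sqfunP.
rewrite -cintegralZ// -cintegralD//; last first.
  have /(_ (a *: f)) := I; congr cintegrable.
  by apply/funext => x; rewrite mulrA.
congr cintegral; apply/funext => x.
have -> : (a *: f + g) x = a * f x + g x by [].
by rewrite mulrDl mulrA.
Qed.

Lemma L2_bilinear : bilinear_for
  ( *%R : GRing.Scale.law R[i] R[i])
  (@conjc R \; *%R : GRing.Scale.law R[i] R[i]) L2_dot.
Proof.
split => [w a u v|u a v w] /=; first exact: L2_dotPl.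
by rewrite 3!(L2_dotJ u) L2_dotPl rmorphD rmorphM.
Qed.

HB.instance Definition _ := bilinear_isBilinear.Build R[i] L2 L2 R[i]
  *%R (@conjc R \; *%R) L2_dot L2_bilinear.

Lemma L2_hermitian u v : L2_dot u v = (-1) ^+ false * (L2_dot v u)^*.
Proof. by rewrite expr0 mul1r [LHS]L2_dotJ. Qed.

HB.instance Definition _ := isHermitianSesquilinear.Build R[i] L2 false
  (@conjc R) L2_dot L2_hermitian.

Lemma L2_dot_gt0 u : u != 0 -> 0 < L2_dot u u.
Proof.
elim/L2_ind: u => f f0; rewrite L2_dot_pi.
have /sqintP[mf If] := sqfunP f.
have -> : cintegral mu setT (fun x => f x * (f x)^*) =
    (Rintegral mu setT (fun x => rnorm (f x : R[i]) ^+ 2)) +i* 0.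
  congr (_ +i* _).
    apply: eq_Rintegral => x _.
    by rewrite Re_mul Re_conj Im_conj rnorm2E mulrN opprK !expr2.
  rewrite [RHS](_ : 0 = \int[mu]_x (cst 0 x)); last first.
    by rewrite /Rintegral integral0.
  apply: eq_Rintegral => x _.
  by rewrite Im_mul Re_conj Im_conj mulrN mulrC addNr.
rewrite ltcE/= eqxx/= lt_neqAle Rintegral_ge0 ?andbT; last first.
  by move=> *; exact: sqr_ge0.
apply: contra f0 => /eqP /esym; rewrite /Rintegral => I0.
have {}I0 : (\int[mu]_x `|(rnorm (f x : R[i]) ^+ 2)%:E| = 0)%E.
  under eq_integral do rewrite gee0_abs ?lee_fin ?sqr_ge0//.
  have /integrable_fin_num := If.
  by move=> /(_ measurableT) /fineK <-; rewrite /= I0.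
rewrite -L2_pi0.
apply/eqP/pi_ae.
move/ae_eq_integral_abs : I0 => /(_ measurableT).
have m2 : measurable_fun setT (fun x => (rnorm (f x : R[i]) ^+ 2)%:E).
  by apply/measurable_EFinP; exact: measurable_rnorm2.
move=> /(_ m2); apply: filterS => x /(_ I) [].
rewrite rnorm2E => /eqP.
rewrite paddr_eq0 ?sqr_ge0// !sqrf_eq0 => /andP[/eqP a0 /eqP b0].
by case: (f x) a0 b0 => a b /= -> ->.
Qed.

HB.instance Definition _ := isDotProduct.Build R[i] L2 L2_dot L2_dot_gt0.

End L2.

Arguments L2_dot {d X R} mu u v.

(* A Borel measure on the spectrum is encoded as a Borel measure on the complex
   plane for which the complement of the spectrum is negligible; [L2 mu] is then
   the L^2 space of the spectrum, also when the spectrum is empty ([H = 0]). *)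
Definition spectral_measure (R : realType) (H : hilbertType R) (T : H -> H)
    (phi : H) (mu : {finite_measure set (borelC R) -> \bar R}) :=
  mu.-negligible (~` spectrum T) /\
  forall (f : Cplx R -> Cplx R) (A : H -> H),
    {within spectrum T, continuous f} -> continuous_calculus T f A ->
    dotp (A phi) phi = cintegral mu (spectrum T) f.

(* Main.v *)
Require Import Defs.
From HB Require Import structures.
From mathcomp Require Import all_boot all_order all_algebra.
From mathcomp Require Import all_classical all_reals all_analysis.
From mathcomp Require Import measurable_realfun complex ring lra.

Set Implicit Arguments.
Unset Strict Implicit.
Unset Printing Implicit Defensive.

Import Order.TTheory GRing.Theory Num.Theory numFieldNormedType.Exports.

Local Open Scope classical_set_scope.
Local Open Scope ring_scope.
Local Open Scope complex_scope.

(** Polynomials sit in both spaces: p gives the vector p(T) phi of H and the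
    function z |-> p(z) of L^2(mu).  Testing the spectral measure on the
    polynomial p q^*, with q^* the coefficientwise conjugate of q, says that the
    two families have the same inner products (gram_poly_op):
      <p(T) phi, q(T) phi> = <(p q^* )(T) phi, phi> = int p(z) (q(z))^* dmu(z),
    where the value of q^* at z is (q(z))^* because the spectrum is real.  Two
    families with equal Gram matrices and dense spans in complete inner product
    spaces are matched by a unitary operator (unitary_of_gram), so it remains to
    check completeness and density on both sides.

    Completeness of H is part of its definition (hilbert_complete); for L^2(mu)
    it is the Riesz-Fischer theorem (L2_complete).  Density is used in the form
    of totality, only 0 is orthogonal to the family; the projection argument of
    total_dense turns totality into density.  In H, a vector orthogonal to all
    T^k phi vanishes by the lower frame bound (frame_poly_orbit_total).  In
    L^2(mu), polyL2_total uses that the spectrum is a bounded subset of the real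
    line: the polynomials (1 - t^n)^(n 2^n) are bounded and converge pointwise
    on [0, 1] to the indicator of [0, 1/2[, so, after an affine change of
    variable, a function orthogonal to all polynomials has integral 0 over every
    half-line by dominated convergence, hence over every Borel set by Dynkin's
    theorem, hence vanishes almost everywhere.

    That the spectrum is real, bounded and closed comes from one criterion: for
    self-adjoint T, the point l is outside the spectrum iff T - l is bounded
    below (bounded_below_notin_spectrum, notin_spectrum_bounded_below).

    Finally T p(T) phi = (X p)(T) phi, so V carries T to multiplication by z on
    polynomials; pairing V T V^* f with a polynomial q gives <f, X q>, which is
    also the pairing of z f with q, and totality identifies the two. *)

(** * Geometry of inner product spaces *)

Section dot_geometry.
Context (R : realType) (U : lmodType R[i]) (d : {dot U for @conjc R}).
Implicit Types (u v x : U) (a t : R[i]).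

(** The values of the form lie in R[i], but on the diagonal they are real
    (dot_sqnorm); estimates are carried out on these real numbers. *)
Definition sqnorm u : R := complex.Re (d u u).

Lemma dot_conj u v : d u v = (d v u)^*.
Proof. by have := @hermitian_subproof _ _ _ _ d u v; rewrite expr0 mul1r. Qed.

Lemma dotDl u v x : d (u + v) x = d u x + d v x.
Proof. exact: linearDl. Qed.

Lemma dotDr u v x : d x (u + v) = d x u + d x v.
Proof. exact: linearDr. Qed.

Lemma dotBl u v x : d (u - v) x = d u x - d v x.
Proof. exact: linearBl. Qed.

Lemma dotBr u v x : d x (u - v) = d x u - d x v.
Proof. exact: linearBr. Qed.

Lemma dotZl a u v : d (a *: u) v = a * d u v.
Proof. exact: linearZl_LR. Qed.

Lemma dotZr a u v : d u (a *: v) = a^* * d u v.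
Proof. exact: linearZr_LR. Qed.

Lemma dot0l u : d 0 u = 0.
Proof. exact: linear0l. Qed.

Lemma dot0r u : d u 0 = 0.
Proof. exact: linear0r. Qed.

Lemma dot_sqnorm u : d u u = (sqnorm u)%:C.
Proof.
have := dot_conj u u; rewrite /sqnorm; case: (d u u) => a b [] /eqP.
by rewrite -addr_eq0 -mulr2n mulrn_eq0/= => /eqP ->.
Qed.

Lemma sqnormD u v :
  sqnorm (u + v) = sqnorm u + sqnorm v + 2 * complex.Re (d u v).
Proof.
rewrite /sqnorm dotDl !dotDr (dot_conj v u).
case: (d u u) (d v v) (d u v) => [? ?] [? ?] [? ?] /=; ring.
Qed.

Lemma sqnormZ a u : sqnorm (a *: u) = rnorm a ^+ 2 * sqnorm u.
Proof.
rewrite /sqnorm dotZl dotZr dot_sqnorm rnorm2E.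
by case: a => p q /=; ring.
Qed.

Lemma sqnormN u : sqnorm (- u) = sqnorm u.
Proof.
by rewrite -scaleN1r sqnormZ rnorm2E/= oppr0 expr0n addr0 sqrrN expr1n mul1r.
Qed.

Lemma sqnormB u v :
  sqnorm (u - v) = sqnorm u + sqnorm v - 2 * complex.Re (d u v).
Proof.
rewrite sqnormD sqnormN -scaleN1r dotZr rmorphN rmorph1 mulN1r.
by case: (d u v) => ? ? /=; ring.
Qed.

Lemma sqnorm0 : sqnorm 0 = 0.
Proof. by rewrite /sqnorm dot0l. Qed.

Lemma sqnorm_ge0 u : 0 <= sqnorm u.
Proof.
have [->|u0] := eqVneq u 0; first by rewrite sqnorm0.
by have := dnorm_ge0 d u; rewrite dot_sqnorm ler0c.
Qed.

Lemma sqnorm_eq0 u : sqnorm u = 0 -> u = 0.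
Proof.
by move=> u0; apply/eqP; rewrite -(dnorm_eq0 d); apply/eqP; rewrite dot_sqnorm u0.
Qed.

Lemma sqnorm_parallelogram u v :
  sqnorm (u - v) = 2 * sqnorm u + 2 * sqnorm v - sqnorm (u + v).
Proof. by rewrite sqnormB sqnormD; ring. Qed.

Lemma sqnormD_le u v : sqnorm (u + v) <= 2 * (sqnorm u + sqnorm v).
Proof. by have := sqnorm_ge0 (u - v); rewrite sqnormB sqnormD; lra. Qed.

Lemma sqnormB_le u v x : sqnorm (u - v) <= 2 * (sqnorm (u - x) + sqnorm (v - x)).
Proof.
rewrite -[X in _ * (_ + X)]sqnormN opprB (le_trans _ (sqnormD_le _ _))//.
by rewrite addrA subrK.
Qed.

(** First variation of the quadratic function t |-> ||x + t v||^2: it drops by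
    |<x, v>|^2 / ||v||^2 at its minimum.  With e = ||x||^2 this is the
    Cauchy-Schwarz inequality; with e small it says that a vector of almost
    minimal norm in a coset is almost orthogonal to the subspace. *)
Lemma dot_le_almost_min x v (e : R) :
  (forall t, sqnorm x - e <= sqnorm (x + t *: v)) ->
  rnorm (d x v) ^+ 2 <= e * sqnorm v.
Proof.
move=> xmin; have [v0|/eqP v0] := eqVneq v 0.
  by rewrite v0 dot0r sqnorm0 mulr0 rnorm2E/= expr0n addr0.
have N0 : 0 < sqnorm v.
  by rewrite lt_neqAle sqnorm_ge0 andbT eq_sym; apply/eqP => /sqnorm_eq0.
(* the minimum is attained at t = - <x, v> / ||v||^2 *)
have := xmin (- ((sqnorm v)^-1%:C * d x v)).
have -> : sqnorm (x + - ((sqnorm v)^-1%:C * d x v) *: v) =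
    sqnorm x - rnorm (d x v) ^+ 2 / sqnorm v.
  rewrite sqnormD sqnormZ dotZr !rnorm2E; case: (d x v) => p q /=.
  by field; rewrite gt_eqF.
by rewrite lerD2l lerN2 ler_pdivrMr.
Qed.

Lemma dot_CauchySchwarz u v : rnorm (d u v) ^+ 2 <= sqnorm u * sqnorm v.
Proof. by apply: dot_le_almost_min => t; rewrite subrr sqnorm_ge0. Qed.

(** Convergence of the sequences whose steps decay geometrically is equivalent
    to completeness, since any Cauchy sequence has such a subsequence.  A fixed
    rate makes the series of steps directly summable, which is what the
    pointwise argument in L^2 uses. *)
Definition dot_complete := forall (u : nat -> U) (C : R),
  (forall n, sqnorm (u n.+1 - u n) <= C * 16^-1 ^+ n) ->
  exists l, sqnorm (u n - l) @[n --> \oo] --> (0 : R).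

Definition dot_total (E : Type) (a : E -> U) :=
  forall u, (forall p, d u (a p) = 0) -> u = 0.

End dot_geometry.

Lemma rnorm_sq_small (R : realType) (z : R[i]) :
  (forall e : R, 0 < e -> rnorm z ^+ 2 <= e) -> z = 0.
Proof.
move=> H; have : rnorm z ^+ 2 <= 0 by apply/ler_addgt0Pl => e e0; rewrite addr0 H.
rewrite rnorm2E => z0.
have /eqP : complex.Re z ^+ 2 + complex.Im z ^+ 2 = 0.
  by apply/eqP; rewrite eq_le z0 addr_ge0 ?sqr_ge0.
rewrite paddr_eq0 ?sqr_ge0// !sqrf_eq0 => /andP[/eqP + /eqP +].
by case: z {H z0} => a b /= -> ->.
Qed.

Section dense.
Context (R : realType) (U E : lmodType R[i]) (d : {dot U for @conjc R}).
Variable a : {linear E -> U}.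

(** The orthogonal projection argument: a sequence in the range of a that
    minimizes the distance to u is Cauchy by the parallelogram law, and u minus
    its limit is orthogonal to the range, hence 0. *)
Lemma total_dense : dot_complete d -> dot_total d a ->
  forall u (e : R), 0 < e -> exists p, sqnorm d (u - a p) < e.
Proof.
move=> dc da u.
pose D := [set sqnorm d (u - a p) | p in [set: E]].
have D0 : has_inf D.
  split; first by exists (sqnorm d (u - a 0)); exists 0.
  by exists 0 => _ [p _ <-]; exact: sqnorm_ge0.
have infD p : inf D <= sqnorm d (u - a p).
  by apply: ge_inf; [case: D0|exists p].
have near n : exists p, sqnorm d (u - a p) < inf D + 16^-1 ^+ n.
  have [|_ [p _ <-] hp] := @inf_adherent _ D (16^-1 ^+ n) _ D0.
    by rewrite exprn_gt0// invr_gt0.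
  by exists p.
have {near}[p hp] := choice near.
have [|l hl] := dc (fun n => a (p n)) 4.
  move=> n; set x := u - a (p n); set y := u - a (p n.+1).
  have -> : a (p n.+1) - a (p n) = x - y.
    by rewrite /x /y opprB [RHS]addrC addrA subrK.
  (* (x + y) / 2 is again u minus a point of the range *)
  have : 4 * inf D <= sqnorm d (x + y).
    have -> : x + y = 2%:R%:C *: (u - a (2^-1%:C *: (p n + p n.+1))).
      rewrite linearZ linearD/= scalerBr scalerA -rmorphM/= divff//.
      rewrite rmorph1 scale1r /x /y opprD addrACA; congr (_ + _).
      by rewrite rmorph_nat scaler_nat mulr2n.
    rewrite sqnormZ rnorm2E/= (expr2 0) mulr0 addr0.
    by have := infD (2^-1%:C *: (p n + p n.+1)); lra.
  rewrite sqnorm_parallelogram; have := hp n; have := hp n.+1.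
  rewrite -/x -/y exprS.
  have : 0 < 16^-1 ^+ n :> R by rewrite exprn_gt0// invr_gt0.
  lra.
have ul : u - l = 0.
  apply: da => q; apply: rnorm_sq_small => e e0.
  have small (c : R) : 0 < c ->
      exists n, sqnorm d (a (p n) - l) <= c /\ 16^-1 ^+ n <= c.
    move=> c0.
    have g : (16^-1 ^+ n : R) @[n --> \oo] --> (0 : R).
      by apply: cvg_expr; rewrite ger0_norm; lra.
    have h1 := cvgr_le 0 hl _ c0; have h2 := cvgr_le 0 g _ c0.
    have [n _ hn] := filterI (h1 _) (h2 _).
    by exists n; have [] := hn n (leqnn n).
  pose N := sqnorm d (a q) + 1.
  have N0 : 0 < N by rewrite ltr_wpDl// sqnorm_ge0.
  have [|n [h1 h2]] := small (e / (4 * N)); first by rewrite divr_gt0// mulr_gt0.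
  have k1 : rnorm (d (u - a (p n)) (a q)) ^+ 2 <= 16^-1 ^+ n * sqnorm d (a q).
    apply: dot_le_almost_min => t.
    rewrite (le_trans (y := inf D))//; first by have := hp n; lra.
    have -> : u - a (p n) + t *: a q = u - a (p n - t *: q).
      by rewrite linearB/= linearZ/= opprB addrAC addrA.
    exact: infD.
  have k2 := dot_CauchySchwarz d (a (p n) - l) (a q).
  have -> : u - l = (u - a (p n)) + (a (p n) - l) by rewrite addrA subrK.
  rewrite dotDl; move: k1 k2; rewrite !rnorm2E Re_add Im_add.
  have b1 (c : R) : c <= e / (4 * N) -> c * sqnorm d (a q) <= e / 4.
    move=> hc; rewrite (le_trans (ler_wpM2r (sqnorm_ge0 _ _) hc))//.
    have -> : e / 4 = e / (4 * N) * N by field; rewrite gt_eqF.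
    by rewrite ler_wpM2l ?lerDl// divr_ge0 ?ltW// mulr_gt0.
  have := b1 _ h1; have := b1 _ h2.
  move: (complex.Re _) (complex.Im _) (complex.Re _) (complex.Im _) => r s r' s'.
  have := sqr_ge0 (r - r'); have := sqr_ge0 (s - s').
  rewrite !expr2; lra.
have {ul} -> : u = l by apply/eqP; rewrite -subr_eq0 ul.
move=> e e0; have h1 := cvgr_lt 0 hl _ e0.
have [n _ /(_ n (leqnn n)) hn] := h1 _; exists (p n).
by rewrite -sqnormN opprB.
Qed.

End dense.

(** * Unitary operators from equal Gram matrices *)

Section transport.
Context (R : realType) (U W E : lmodType R[i]).
Variables (dU : {dot U for @conjc R}) (dW : {dot W for @conjc R}).
Variables (a : {linear E -> U}) (b : {linear E -> W}).
Hypothesis Uc : dot_complete dU.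
Hypothesis Wc : dot_complete dW.
Hypothesis at0 : dot_total dU a.
Hypothesis bt0 : dot_total dW b.
Hypothesis gram : forall p q, dU (a p) (a q) = dW (b p) (b q).

(** Two relations between U and W describe the graph of the unitary operator.
    This one holds for limits along a common sequence of E; completeness makes
    it everywhere defined (same_approx_ex). *)
Definition same_approx x y := forall e : R, 0 < e ->
  exists p, sqnorm dU (x - a p) < e /\ sqnorm dW (y - b p) < e.

(** This one is visibly linear, and single-valued by totality (same_coef_inj). *)
Definition same_coef x y := forall q, dU x (a q) = dW y (b q).

(** The common approximant p satisfies <x', a p> = <y', b p>, so that
    <x', x> - <y', y> = <x', x - a p> - <y', y - b p> is as small as desired.
    This both compares the two relations and shows that the graph is isometric. *)
Lemma same_coef_approx x y x' y' : same_coef x' y' -> same_approx x y ->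
  dU x' x = dW y' y.
Proof.
move=> c' xy; apply/eqP; rewrite -subr_eq0; apply/eqP.
apply: rnorm_sq_small => e e0.
pose N := sqnorm dU x' + sqnorm dW y' + 1.
have N0 : 0 < N by rewrite ltr_wpDl// addr_ge0// sqnorm_ge0.
have [|p [h1 h2]] := xy (e / (4 * N)); first by rewrite divr_gt0// mulr_gt0.
have -> : dU x' x - dW y' y = dU x' (x - a p) - dW y' (y - b p).
  by rewrite !dotBr c' opprB addrA subrK.
have := dot_CauchySchwarz dU x' (x - a p).
have := dot_CauchySchwarz dW y' (y - b p).
have ee : e / (4 * N) * N = e / 4 by field; rewrite gt_eqF.
have b1 (n c : R) : 0 <= n -> n <= N -> c < e / (4 * N) -> n * c <= e / 4.
  move=> n0 nN ce; rewrite -ee mulrC.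
  rewrite (le_trans (ler_wpM2r n0 (ltW ce)))// ler_wpM2l// divr_ge0 ?ltW//.
  by rewrite mulr_gt0.
have [U0 W0] := (sqnorm_ge0 dU x', sqnorm_ge0 dW y').
have := b1 _ _ U0 _ h1; have := b1 _ _ W0 _ h2.
move=> /(_ ltac:(rewrite /N; lra)) hW /(_ ltac:(rewrite /N; lra)) hU.
rewrite !rnorm2E -mulN1r Re_add Im_add Re_mul Im_mul/=.
move: (complex.Re _) (complex.Im _) (complex.Re _) (complex.Im _) => r s r' s'.
have := sqr_ge0 (r + s); have := sqr_ge0 (r' + s').
have := sqr_ge0 (r + r'); have := sqr_ge0 (s + s').
by rewrite !expr2; lra.
Qed.

Lemma same_approxW x y : same_approx x y -> same_coef x y.
Proof.
move=> xy q; rewrite dot_conj [RHS]dot_conj; congr (_ ^*).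
by apply: same_coef_approx xy => r; exact: gram.
Qed.

Lemma same_coef_inj x y y' : same_coef x y -> same_coef x y' -> y = y'.
Proof.
move=> h h'; apply/eqP; rewrite -subr_eq0; apply/eqP; apply: bt0 => q.
by rewrite dotBl -h h' subrr.
Qed.

Lemma same_approx_ex x : exists y, same_approx x y.
Proof.
have near n : exists p, sqnorm dU (x - a p) < 16^-1 ^+ n.
  by apply: total_dense => //; rewrite exprn_gt0// invr_gt0.
have {near}[p hp] := choice near.
have [|y hy] := Wc (u := fun n => b (p n)) (C := 4).
  move=> n; have -> : sqnorm dW (b (p n.+1) - b (p n)) =
      sqnorm dU (a (p n.+1) - a (p n)).
    by rewrite /sqnorm -!linearB -gram.
  rewrite -opprB sqnormN.
  have -> : a (p n) - a (p n.+1) = (x - a (p n.+1)) - (x - a (p n)).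
    by rewrite opprB [RHS]addrC addrA subrK.
  rewrite (le_trans (sqnormB_le _ _ _ 0))// !subr0.
  have := hp n; have := hp n.+1; rewrite exprS.
  have : 0 < 16^-1 ^+ n :> R by rewrite exprn_gt0// invr_gt0.
  by lra.
exists y => e e0.
have g : (16^-1 ^+ n : R) @[n --> \oo] --> (0 : R).
  by apply: cvg_expr; rewrite ger0_norm; lra.
have h1 := cvgr_lt 0 hy _ e0; have h2 := cvgr_lt 0 g _ e0.
have [n _ /(_ n (leqnn n)) [h3 h4]] := filterI (h1 _) (h2 _).
exists (p n); split; first exact: lt_trans (hp n) h4.
by rewrite -sqnormN opprB.
Qed.

End transport.

Section unitary_of_gram.
Context (R : realType) (U W E : lmodType R[i]).
Variables (dU : {dot U for @conjc R}) (dW : {dot W for @conjc R}).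
Variables (a : {linear E -> U}) (b : {linear E -> W}).

(** Both V and its inverse are read off same_approx, in its two symmetric
    readings; an isometric bijection has its inverse as adjoint. *)
Theorem unitary_of_gram :
  dot_complete dU -> dot_complete dW -> dot_total dU a -> dot_total dW b ->
  (forall p q, dU (a p) (a q) = dW (b p) (b q)) ->
  exists (V : {linear U -> W}) (Vs : {linear W -> U}),
    [/\ unitary dU dW V, adjoint dU dW V Vs, cancel Vs V &
        forall p, V (a p) = b p].
Proof.
move=> Uc Wc at0 bt0 gram.
have gram' p q : dW (b p) (b q) = dU (a p) (a q) by rewrite gram.
have [V hV] := choice (same_approx_ex Uc Wc at0 gram).
have [Vs hVs] := choice (same_approx_ex Wc Uc bt0 gram').
have cV x : same_coef dU dW a b x (V x) := same_approxW gram (hV x).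
have cVs y : same_coef dW dU b a y (Vs y) := same_approxW gram' (hVs y).
have Vlin : linear V.
  move=> c x y; apply: (same_coef_inj bt0 (cV _)) => q.
  by rewrite !dotDl !dotZl !cV.
have Vslin : linear Vs.
  move=> c x y; apply: (same_coef_inj at0 (cVs _)) => q.
  by rewrite !dotDl !dotZl !cVs.
have VK : cancel V Vs.
  by move=> x; apply: (same_coef_inj at0 (cVs _)) => q; rewrite cV.
have VsK : cancel Vs V.
  by move=> x; apply: (same_coef_inj bt0 (cV _)) => q; rewrite cVs.
have Viso x y : dW (V x) (V y) = dU x y.
  by rewrite (same_coef_approx (cV x) (hV y)).
pose VL := HB.pack_for {linear U -> W} V (GRing.isLinear.Build _ _ _ _ V Vlin).
pose VsL := HB.pack_for {linear W -> U} Vs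
  (GRing.isLinear.Build _ _ _ _ Vs Vslin).
exists VL, VsL; split => //.
- by split => //; exists Vs.
- by move=> x y; rewrite -[in LHS](VsK y) /= Viso.
- by move=> p; apply: (same_coef_inj bt0 (cV _)) => q; exact: gram.
Qed.

End unitary_of_gram.

(** * The spectrum of a self-adjoint operator *)

Section hilbert_complete.
Context (R : realType) (H : hilbertType R).
Implicit Types x y : H.

Lemma rnormE x : `|x| = (rnorm x)%:C.
Proof.
by apply/eqP; rewrite eq_complex/= eqxx/=; apply/eqP/ger0_Im/normr_ge0.
Qed.

Lemma rnorm_ge0 x : 0 <= rnorm x.
Proof. by have := normr_ge0 x; rewrite rnormE ler0c. Qed.

Lemma rnormD_le x y : rnorm (x + y) <= rnorm x + rnorm y.
Proof. by have := ler_normD x y; rewrite !rnormE -rmorphD lecR. Qed.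

Lemma sqnorm_dotp x : sqnorm dotp x = rnorm x ^+ 2.
Proof. by rewrite /sqnorm dotp_norm rnormE -rmorphXn. Qed.

Lemma hilbert_complete : dot_complete (@dotp R H).
Proof.
(* C + 1 bounds the square root of C *)
move=> u C uC; pose K := C + 1.
have C0 : 0 <= C.
  by have := le_trans (sqnorm_ge0 _ _) (uC 0%N); rewrite expr0 mulr1.
have K0 : 0 < K by rewrite ltr_wpDl.
have step n : rnorm (u n.+1 - u n) <= K * 4^-1 ^+ n.
  have k0 : 0 <= K * 4^-1 ^+ n.
    by rewrite mulr_ge0 ?(ltW K0)// exprn_ge0// invr_ge0.
  rewrite -(@ler_pXn2r _ 2)// ?nnegrE ?rnorm_ge0// -sqnorm_dotp.
  rewrite (le_trans (uC n))// exprMn -exprM mulnC exprM.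
  have -> : 4^-1 ^+ 2 = 16^-1 :> R by field.
  rewrite ler_wpM2r ?exprn_ge0 ?invr_ge0// /K expr2.
  by have := mulr_ge0 C0 C0; lra.
have far n k : rnorm (u (n + k)%N - u n) <= 2 * K * 4^-1 ^+ n.
  have {}far : rnorm (u (n + k)%N - u n) <= 2 * K * (4^-1 ^+ n - 4^-1 ^+ (n + k)).
    elim: k => [|k IH].
      by rewrite addn0 !subrr mulr0 /rnorm normr0.
    have := rnormD_le (u (n + k).+1 - u (n + k)%N) (u (n + k)%N - u n).
    rewrite addrA subrK addnS => /le_trans; apply.
    have := step (n + k)%N; rewrite [4^-1 ^+ (n + k).+1]exprS.
    have := mulr_gt0 K0 (exprn_gt0 (n + k) (_ : 0 < 4^-1 :> R)).
    rewrite invr_gt0 => /(_ (ltr0Sn _ 3)).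
    by move: IH; lra.
  apply: le_trans far _; rewrite ler_wpM2l ?mulr_ge0 ?(ltW K0)//.
  by rewrite gerBl exprn_ge0// invr_ge0.
have g (e : R) : 0 < e -> exists n, 2 * K * 4^-1 ^+ n < e.
  move=> e0; have gc : (2 * K * 4^-1 ^+ n : R) @[n --> \oo] --> 2 * K * 0.
    by apply: cvgMr; apply: cvg_expr; rewrite ger0_norm; lra.
  rewrite mulr0 in gc.
  by have [n _ /(_ n (leqnn n)) hn] := cvgr_lt 0 gc _ e0; exists n.
have /cauchy_cvg /cvg_ex[l ul] : cauchy (u @ \oo).
  apply: cauchy_exP => e e0.
  have eE : e = (complex.Re e)%:C.
    by apply/eqP; rewrite eq_complex/= eqxx/=; apply/eqP/ger0_Im/ltW.
  have [|n hn] := g (complex.Re e); first by rewrite -ltcR -eE.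
  exists (u n); exists n => // m /= nm; rewrite -ball_normE/= eE.
  rewrite distrC rnormE ltcR -(subnKC nm).
  exact: le_lt_trans (far _ _) hn.
exists l; apply/cvgr0Pnorm_lt => e e0.
have s0 : 0 < (Num.sqrt e)%:C by rewrite ltcR sqrtr_gt0.
apply: filterS (cvgr_dist_lt _ _ ul _ s0) => n.
rewrite distrC rnormE ltcR => hn.
rewrite ger0_norm ?sqnorm_ge0// sqnorm_dotp -(sqr_sqrtr (ltW e0)).
by rewrite ltrXn2r// rnorm_ge0.
Qed.

End hilbert_complete.

Section self_adjoint_spectrum.
Context (R : realType) (H : hilbertType R).
Variable T : {linear H -> H}.
Hypothesis Tb : bounded_op T.
Hypothesis Tsa : self_adjoint T.

Let shift (l : R[i]) (x : H) : H := T x - l *: x.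

Let shift_linear l : linear (shift l).
Proof.
move=> c x y; rewrite /shift linearP scalerDr scalerBr opprD addrACA.
by rewrite !scalerA mulrC.
Qed.

Let shiftL l : {linear H -> H} :=
  HB.pack_for {linear H -> H} (shift l)
    (GRing.isLinear.Build _ _ _ _ (shift l) (shift_linear l)).

Lemma dot_self_adjoint_real x : complex.Im (dotp (T x) x) = 0.
Proof.
have := Tsa x x; rewrite [RHS]dot_conj; case: (dotp (T x) x) => p q [] /eqP.
by rewrite -addr_eq0 -mulr2n mulrn_eq0/= => /eqP ->.
Qed.

(** The cross term vanishes because <T x, x> is real.  In particular T - l and
    its adjoint T - l^* have the same norm at every vector. *)
Lemma sqnorm_shift (l : R[i]) x : sqnorm dotp (shift l x) =
  sqnorm dotp (shift (complex.Re l)%:C x) + complex.Im l ^+ 2 * sqnorm dotp x.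
Proof.
rewrite /shift !sqnormB !sqnormZ !dotZr !rnorm2E.
have := dot_self_adjoint_real x.
case: (dotp (T x) x) => p q /= ->; case: l => r s /=.
by ring.
Qed.

(** Being bounded below makes T - l injective with closed range; the orthogonal
    complement of the range is the kernel of T - l^*, which is also 0 by
    sqnorm_shift.  So T - l is bijective with an inverse of norm at most
    c^(-1/2). *)
Lemma bounded_below_notin_spectrum (l : R[i]) (c : R) : 0 < c ->
  (forall x, c * sqnorm dotp x <= sqnorm dotp (shift l x)) -> ~ spectrum T l.
Proof.
move=> c0 hc; apply.
have [a aE] : exists a : {linear H -> H}, forall x, a x = shift l x.
  by exists (shiftL l).
have at0 : dot_total dotp a.
  move=> u hu; apply: (sqnorm_eq0 (d := dotp)).
  have su : shift l^* u = 0.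
    have adj v : dotp (shift l^* u) v = dotp u (shift l v).
      by rewrite /shift dotBl dotBr dotZl dotZr Tsa.
    by apply: (sqnorm_eq0 (d := dotp)); rewrite /sqnorm adj -aE hu.
  have : sqnorm dotp (shift l u) = 0.
    have <- : sqnorm dotp (shift l^* u) = 0 by rewrite su sqnorm0.
    rewrite (sqnorm_shift l u) (sqnorm_shift l^* u).
    by rewrite Defs.Re_conj Defs.Im_conj sqrrN.
  move=> l0; have := hc u; rewrite l0 pmulr_rle0// => u0.
  by apply/eqP; rewrite eq_le u0 sqnorm_ge0.
have inj : injective a.
  move=> x y xy; apply/eqP; rewrite -subr_eq0; apply/eqP.
  apply: (sqnorm_eq0 (d := dotp)); apply/eqP; rewrite eq_le sqnorm_ge0 andbT.
  have := hc (x - y); rewrite -aE linearB.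
  by rewrite xy subrr sqnorm0 pmulr_rle0.
have [M hM] := Tb.
have sb : exists2 B : R, 0 <= B &
    forall x, sqnorm dotp (a x) <= B * sqnorm dotp x.
  exists (2 * (M ^+ 2 + rnorm l ^+ 2)) => [|x].
    by rewrite mulr_ge0// addr_ge0// sqr_ge0.
  rewrite aE /shift (le_trans (sqnormD_le _ _ _))// -mulrA ler_wpM2l// mulrDl.
  rewrite lerD// ?sqnormN ?sqnormZ// !sqnorm_dotp -exprMn.
  have := hM x; have := rnorm_ge0 (T x); move: (rnorm _) (M * _) => r s r0 rs.
  by rewrite ler_pXn2r// nnegrE (le_trans r0).
have surj y : exists x, a x = y.
  have near n : exists p, sqnorm dotp (y - a p) < 16^-1 ^+ n.
    apply: (total_dense (@hilbert_complete _ H) at0).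
    by rewrite exprn_gt0// invr_gt0.
  have {near}[p hp] := choice near.
  have [|x hx] := @hilbert_complete _ H p (4 / c).
    move=> n; rewrite mulrAC ler_pdivlMr// mulrC.
    rewrite (le_trans (hc _))//.
    have -> : shift l (p n.+1 - p n) = (y - a (p n)) - (y - a (p n.+1)).
      by rewrite opprB [RHS]addrC addrA subrK -linearB aE.
    rewrite (le_trans (sqnormB_le _ _ _ 0))// !subr0.
    have := hp n; have := hp n.+1; rewrite exprS.
    have : 0 < 16^-1 ^+ n :> R by rewrite exprn_gt0// invr_gt0.
    by lra.
  exists x; apply/esym/eqP; rewrite -subr_eq0; apply/eqP.
  apply: (sqnorm_eq0 (d := dotp)); apply/eqP; rewrite eq_le sqnorm_ge0 andbT.
  apply/ler_addgt0Pl => e e0; rewrite addr0.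
  have [B B0 hB] := sb; pose N := B + 1; have N0 : 0 < N by rewrite ltr_wpDl.
  have h1 : \forall n \near \oo, sqnorm dotp (p n - x) < e / (4 * N).
    by apply: (cvgr_lt 0) => //; rewrite divr_gt0// mulr_gt0.
  have h2 : \forall n \near \oo, (16^-1 ^+ n : R) < e / 4.
    apply: (cvgr_lt 0); last by rewrite divr_gt0.
    by apply: cvg_expr; rewrite ger0_norm; lra.
  have [n _ /(_ n (leqnn n)) [h3 h4]] := filterI h1 h2.
  rewrite (le_trans (sqnormB_le _ _ _ (a (p n))))//.
  have := lt_trans (hp n) h4; rewrite -(sqnormN dotp (a x - _)) opprB -linearB/=.
  have := hB (p n - x).
  have ee : e / (4 * N) * N = e / 4 by field; rewrite gt_eqF.
  have : B * sqnorm dotp (p n - x) <= e / (4 * N) * N.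
    by rewrite mulrC ler_pM ?sqnorm_ge0 ?(ltW h3)// lerDl.
  by rewrite ee; lra.
have [S hS] := choice surj.
have Slin : linear S.
  by move=> k x y; apply: inj; rewrite linearP !hS.
exists (HB.pack_for {linear H -> H} S (GRing.isLinear.Build _ _ _ _ S Slin)).
split=> /=; last by move=> x; rewrite -[RHS](hS x) aE.
  exists (Num.sqrt c^-1) => x /=.
  rewrite -(@ler_pXn2r _ 2)// ?nnegrE ?rnorm_ge0 ?mulr_ge0 ?rnorm_ge0 ?sqrtr_ge0//.
  rewrite exprMn sqr_sqrtr ?invr_ge0 ?(ltW c0)// -!sqnorm_dotp.
  by rewrite mulrC ler_pdivlMr// mulrC (le_trans (hc _))// -aE hS.
by move=> x; apply: inj; rewrite hS aE.
Qed.

Lemma notin_spectrum_bounded_below (l : R[i]) : ~ spectrum T l ->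
  exists2 c : R, 0 < c &
    forall x, c * sqnorm dotp x <= sqnorm dotp (shift l x).
Proof.
move/contrapT => [S [[M hM] SK _]]; pose K := M ^+ 2 + 1.
have K0 : 0 < K by rewrite ltr_wpDl// sqr_ge0.
exists K^-1; first by rewrite invr_gt0.
move=> x; rewrite mulrC ler_pdivrMr// mulrC.
have := hM (shift l x); rewrite SK => h.
rewrite sqnorm_dotp (le_trans (y := (M * rnorm (shift l x)) ^+ 2))//.
  by rewrite ler_pXn2r// nnegrE ?rnorm_ge0// (le_trans _ h)// rnorm_ge0.
by rewrite exprMn -sqnorm_dotp ler_wpM2r ?sqnorm_ge0// lerDl.
Qed.

(** By sqnorm_shift, T - l is bounded below by |Im l|. *)
Lemma spectrum_real (l : R[i]) : spectrum T l -> complex.Im l = 0.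
Proof.
move=> Tl; apply/eqP/negPn/negP => l0.
apply: (@bounded_below_notin_spectrum l (complex.Im l ^+ 2)) Tl => [|x].
  by rewrite lt_neqAle sqr_ge0 andbT eq_sym sqrf_eq0.
by rewrite [leRHS]sqnorm_shift lerDr sqnorm_ge0.
Qed.

Lemma spectrum_bounded :
  exists2 M : R, 0 <= M & forall l, spectrum T l -> `|complex.Re l| <= M.
Proof.
(* beyond this radius the norm of l x dominates that of T x *)
have [M hM] := Tb; exists (2 * `|M| + 1); first by rewrite addr_ge0// mulr_ge0.
move=> l Tl; rewrite leNgt; apply/negP => lM.
apply: (@bounded_below_notin_spectrum l 4^-1) Tl => [|x]; first by rewrite invr_gt0.
have r0 := rnorm_ge0 x.
have h1 : sqnorm dotp (T x) <= M ^+ 2 * sqnorm dotp x.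
  rewrite !sqnorm_dotp -exprMn ler_pXn2r// nnegrE ?rnorm_ge0//.
  by rewrite (le_trans _ (hM x))// rnorm_ge0.
have h2 : (4 * M ^+ 2 + 1) * sqnorm dotp x <= complex.Re l ^+ 2 * sqnorm dotp x.
  rewrite ler_wpM2r ?sqnorm_ge0// -(real_normK (num_real M)).
  rewrite -(real_normK (num_real (complex.Re l))).
  have := normr_ge0 M; move: `|M| `|complex.Re l| lM => m k lM m0.
  by rewrite !expr2; nra.
have h3 : complex.Re l ^+ 2 * sqnorm dotp x <= sqnorm dotp (l *: x).
  by rewrite sqnormZ rnorm2E ler_wpM2r ?sqnorm_ge0// lerDl sqr_ge0.
have h4 : sqnorm dotp (l *: x) <=
    2 * (sqnorm dotp (T x) + sqnorm dotp (shift l x)).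
  have -> : l *: x = T x - shift l x by rewrite /shift opprB addrC subrK.
  by rewrite (le_trans (sqnormB_le _ _ _ 0))// !subr0.
by have := sqnorm_ge0 (@dotp R H) x; nra.
Qed.

(** A lower bound for T - l persists, with a worse constant, for T - l' when l'
    is close to l. *)
Lemma spectrum_closed : @closed (Cplx R) (spectrum T).
Proof.
rewrite -[spectrum T]setCK; apply: open_closedC; rewrite openE => l Tl.
have [c c0 hc] := notin_spectrum_bounded_below Tl.
have c4 : 0 < c / 4 by rewrite divr_gt0.
apply/nbhs_ballP; exists (Num.sqrt (c / 4))%:C.
  by rewrite /= ltcR sqrtr_gt0.
move=> l'; rewrite -ball_normE/= => ll'.
apply: (@bounded_below_notin_spectrum l' (c / 4)) => // x.
have {}ll' : rnorm (l - l' : R[i]) ^+ 2 <= c / 4.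
  rewrite -(sqr_sqrtr (ltW c4)); have := ltW ll'.
  have -> : `|(l : Cplx R) - l'| = (rnorm (l - l' : R[i]))%:C.
    by rewrite /rnorm [LHS]normc_def normc_def.
  rewrite lecR => h; rewrite ler_pXn2r// nnegrE ?sqrtr_ge0//.
  by have := normr_ge0 (l - l' : R[i]); rewrite lecE => /andP[].
have := hc x.
have -> : shift l x = shift l' x - (l - l') *: x.
  by rewrite /shift scalerBl opprB addrA subrK.
move=> /le_trans/(_ (sqnormB_le _ _ _ 0)); rewrite !subr0 sqnormZ.
have := ler_wpM2r (sqnorm_ge0 dotp x) ll'.
by lra.
Qed.

End self_adjoint_spectrum.

(** * Polynomials of an operator *)

(** Over a numFieldType, so that it applies to R[i] as well. *)
Lemma horner_continuous (K : numFieldType) (p : {poly K}) :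
  continuous ((fun z => p.[z]) : K -> K).
Proof.
elim/poly_ind: p => [|p c IH] z.
  have -> : (fun z => (0 : {poly K}).[z]) = (cst 0 : K -> K).
    by apply/funext => w; rewrite horner0.
  exact: cst_continuous.
have -> : (fun w => (p * 'X + c%:P).[w]) = (fun w : K => p.[w] * w + c).
  by apply/funext => w; rewrite hornerMXaddC.
have h : {for z, continuous (fun w : K => p.[w] * w)}.
  by apply: continuousM; [exact: IH|exact: cvg_id].
by apply: (continuousD h); exact: cst_continuous.
Qed.


Section polynomial_calculus.
Context (R : realType) (H : hilbertType R).
Variable T : {linear H -> H}.
Implicit Types (p q : {poly R[i]}) (x y : H).

Lemma poly_op_wide p n x : (size p <= n)%N ->
  poly_op T p x = \sum_(i < n) p`_i *: iter i T x.
Proof.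
move=> pn; rewrite /poly_op (big_ord_widen n (fun i => p`_i *: iter i T x))//.
rewrite big_mkcond/=; apply: eq_bigr => i _; case: ltnP => // pi.
by rewrite nth_default// scale0r.
Qed.

Lemma poly_op_linear x : linear (poly_op T ^~ x).
Proof.
move=> c p q; pose n := maxn (size (c *: p + q)) (maxn (size p) (size q)).
rewrite !(@poly_op_wide _ n) ?leq_max ?leqnn ?orbT//.
rewrite scaler_sumr -big_split/=; apply: eq_bigr => i _.
by rewrite coefD coefZ scalerDl scalerA.
Qed.

Definition poly_orbit x : {linear {poly R[i]} -> H} :=
  HB.pack_for {linear {poly R[i]} -> H} (poly_op T ^~ x)
    (GRing.isLinear.Build _ _ _ _ (poly_op T ^~ x) (poly_op_linear x)).

Lemma poly_opD p q x : poly_op T (p + q) x = poly_op T p x + poly_op T q x.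
Proof. exact: (linearD (poly_orbit x)). Qed.

Lemma poly_opC c x : poly_op T c%:P x = c *: x.
Proof.
by rewrite (@poly_op_wide _ 1) ?size_polyC_leq1// big_ord1 coefC.
Qed.

Lemma poly_opMX p x : poly_op T (p * 'X) x = T (poly_op T p x).
Proof.
rewrite (@poly_op_wide _ (size p).+1); last first.
  by rewrite (leq_trans (size_polyMleq _ _))// size_polyX addn2.
rewrite big_ord_recl coefMX scale0r add0r /poly_op linear_sum.
by apply: eq_bigr => i _; rewrite coefMX/= linearZ.
Qed.

Lemma poly_opXn k x : poly_op T 'X^k x = iter k T x.
Proof.
elim: k => [|k IH]; first by rewrite expr0 poly_opC scale1r.
by rewrite exprSr poly_opMX IH.
Qed.

Lemma poly_opM p q x : poly_op T (p * q) x = poly_op T p (poly_op T q x).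
Proof.
elim/poly_ind: p x => [|p c IH] x.
  by rewrite mul0r -polyC0 !poly_opC !scale0r.
rewrite mulrDl -mulrA (mulrC 'X) mulrA !poly_opD !poly_opMX IH.
congr (_ + _); rewrite poly_opC mul_polyC.
exact: (linearZ_LR (poly_orbit x)).
Qed.

Hypothesis Tsa : self_adjoint T.

Lemma poly_op_adjoint p x y :
  dotp x (poly_op T p y) = dotp (poly_op T (map_poly (@conjc R) p) x) y.
Proof.
elim/poly_ind: p x y => [|p c IH] x y.
  by rewrite rmorph0 -polyC0 !poly_opC !scale0r dot0l dot0r.
rewrite rmorphD rmorphM/= map_polyX map_polyC/= !poly_opD dotDl dotDr.
rewrite !poly_opC dotZl dotZr poly_opMX -Tsa IH; congr (dotp _ y + _).
by rewrite poly_opM -[in RHS](mul1r 'X) -[1]/(1%:P) poly_opMX poly_opC scale1r.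
Qed.

Lemma continuous_calculus_poly p :
  continuous_calculus T (fun z => p.[z]) (poly_op T p).
Proof.
exists (fun=> p); split.
  by move=> W nW; exists 0%N => // n _ /=; exact: nbhs_singleton nW.
move=> e e0; near=> n => x; rewrite subrr {1}/rnorm normr0 mulr_ge0 ?(ltW e0)//.
exact: rnorm_ge0.
Unshelve. all: by end_near.
Qed.

(** Moving q(T) across the inner product leaves a single polynomial of T applied
    to phi, to which the defining property of the spectral measure applies. *)
Lemma gram_poly_op phi (mu : {finite_measure set (borelC R) -> \bar R}) p q :
  spectral_measure T phi mu ->
  dotp (poly_op T p phi) (poly_op T q phi) =
  cintegral mu (spectrum T) (fun z => p.[z] * (map_poly (@conjc R) q).[z]).
Proof.
move=> [_ smu]; rewrite poly_op_adjoint -poly_opM mulrC.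
rewrite (smu (fun z => (p * map_poly (@conjc R) q).[z])).
- by congr cintegral; apply/funext => z; rewrite hornerM.
- by apply: continuous_subspaceT; exact: (@horner_continuous R[i]).
- exact: continuous_calculus_poly.
Qed.

End polynomial_calculus.

(** * Completeness of L2 *)

(** The sequences u n - 2 K / 2^n and u n + 2 K / 2^n are monotone and bracket
    the limit, which gives the rate of convergence at once. *)
Lemma geometric_limit (R : realType) (u : nat -> R) (K : R) :
  (forall n, `|u n.+1 - u n| <= K * 2^-1 ^+ n) ->
  exists l, forall n, `|u n - l| <= 2 * K * 2^-1 ^+ n.
Proof.
move=> uK; pose w n := u n - 2 * K * 2^-1 ^+ n.
pose v n := u n + 2 * K * 2^-1 ^+ n.
have wS n : w n <= w n.+1.
  by have := uK n; rewrite ler_norml => /andP[+ _]; rewrite /w exprS; lra.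
have vS n : v n.+1 <= v n.
  by have := uK n; rewrite ler_norml => /andP[_]; rewrite /v exprS; lra.
have wnd : {homo w : n m / (n <= m)%N >-> n <= m}.
  by apply: homo_leq => // y x z; exact: le_trans.
have vni : {homo v : n m / (n <= m)%N >-> n >= m}.
  by apply: homo_leq => // y x z xy yz; exact: le_trans yz xy.
have wv n m : w n <= v m.
  rewrite (le_trans (wnd _ _ (leq_maxl n m)))//.
  rewrite (le_trans _ (vni _ _ (leq_maxr n m)))//.
  have K0 : 0 <= K.
    by have := le_trans (normr_ge0 _) (uK 0%N); rewrite expr0 mulr1.
  rewrite /w /v; set e := 2 * K * _.
  have : 0 <= e by rewrite !mulr_ge0// exprn_ge0// invr_ge0.
  by lra.
have w0 : has_sup (range w).
  by split; [exists (w 0%N), 0%N|exists (v 0%N) => _ [n _ <-]; exact: wv].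
exists (sup (range w)) => n; rewrite ler_distl.
have : sup (range w) <= v n.
  by apply: ge_sup; [case: w0|move=> _ [m _ <-]; exact: wv].
have : w n <= sup (range w) by apply: ub_le_sup; [case: w0|exists n].
by rewrite /w /v => ? ?; apply/andP; split; lra.
Qed.

Section L2_complete.
Context d (X : measurableType d) (R : realType).
Variable mu : {measure set X -> \bar R}.

(** Riesz-Fischer.  The function S = sum_n 4^n (f (n+1) - f n)^2 has finite
    integral because the weight 4^n still leaves a decay of 4^-n.  Where S is
    finite the steps are at most sqrt(S) / 2^n, so f n converges there, and the
    distance to the limit satisfies (f n - g)^2 <= 4 S / 4^n; where S is
    infinite that bound is trivial, so it can be integrated. *)
Lemma fast_Cauchy_ae_limit (f : nat -> X -> R) (C : R) :
  (forall n, measurable_fun setT (f n)) ->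
  (forall n, (\int[mu]_x ((f n.+1 x - f n x) ^+ 2)%:E <=
    (C * 16^-1 ^+ n)%:E)%E) ->
  exists2 g : X -> R, measurable_fun setT g &
    exists D : R, forall n,
      (\int[mu]_x ((f n x - g x) ^+ 2)%:E <= (D * 4^-1 ^+ n)%:E)%E.
Proof.
move=> mf hf.
pose h n x := (4 ^+ n * (f n.+1 x - f n x) ^+ 2)%:E.
have h0 n x : (0 <= h n x)%E by rewrite lee_fin mulr_ge0 ?sqr_ge0// exprn_ge0.
have md n : measurable_fun setT (fun x => (f n.+1 x - f n x) ^+ 2).
  by apply: measurable_funX; exact: measurable_funB.
have mh n : measurable_fun setT (h n).
  by apply/measurable_EFinP; apply: measurable_funM => //; exact: measurable_cst.
pose S x := (\sum_(n <oo) h n x)%E.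
have S0 x : (0 <= S x)%E by apply: nneseries_ge0.
have mS : measurable_fun setT S by apply: ge0_emeasurable_sum.
have C0 : 0 <= C.
  have := hf 0%N; rewrite expr0 mulr1 -lee_fin; apply: le_trans.
  by apply: integral_ge0 => x _; rewrite lee_fin sqr_ge0.
have IS : (\int[mu]_x S x <= (C * (1 - 4^-1)^-1)%:E)%E.
  rewrite integral_nneseries//.
  apply: lime_le; first by apply: is_cvg_nneseries => n _ _; apply: integral_ge0.
  apply: nearW => n.
  apply: (@le_trans _ _ (series (geometric C 4^-1) n)%:E); last first.
    by rewrite lee_fin geometric_le_lim// ?invr_gt0// ger0_norm; lra.
  rewrite /series/= -sumEFin; apply: lee_sum => k _.
  rewrite /h; under eq_integral do rewrite EFinM.
  rewrite ge0_integralZl//; last 2 first.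
  - exact/measurable_EFinP.
  - by move=> x _; rewrite lee_fin sqr_ge0.
  rewrite (le_trans (lee_wpmul2l _ (hf k)))// ?lee_fin ?exprn_ge0//.
  by rewrite mulrCA -exprMn (_ : 4 * 16^-1 = 4^-1)//; field.
pose E := [set x | S x \is a fin_num].
have mE : measurable E.
  by have := emeasurable_fin_num measurableT mS; rewrite setTI.
have SE x : E x -> S x = (fine (S x))%:E by move=> Ex; rewrite fineK.
have lim x : exists l, (E x -> forall n,
    `|f n x - l| <= 2 * Num.sqrt (fine (S x)) * 2^-1 ^+ n) /\ (~ E x -> l = 0).
  have [Ex|nEx] := pselect (E x); last by exists 0.
  have [|l hl] := @geometric_limit R (f ^~ x) (Num.sqrt (fine (S x))).
    move=> n; have : (h n x <= S x)%E.
      apply: le_trans (nneseries_lim_ge n.+1 _) => //.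
      by rewrite big_nat_recr//= leeDr// sume_ge0.
    move=> hS; have {}hS : 4 ^+ n * (f n.+1 x - f n x) ^+ 2 <= fine (S x).
      by rewrite -lee_fin -(SE _ Ex).
    rewrite -(@ler_pXn2r _ 2) ?nnegrE// ?mulr_ge0 ?sqrtr_ge0 ?exprn_ge0 ?invr_ge0//.
    rewrite real_normK ?num_real// exprMn sqr_sqrtr ?fine_ge0//.
    rewrite -exprM mulnC exprM.
    have -> : 2^-1 ^+ 2 = 4^-1 :> R by field.
    by rewrite exprVn ler_pdivlMr ?exprn_gt0// mulrC.
  by exists l; split.
have {lim}[g hg] := choice lim.
have mg : measurable_fun setT g.
  apply: (@measurable_fun_cvg _ _ _ _ (fun n x => f n x * \1_E x)) => [m|x _].
    by apply: measurable_funM => //; exact: measurable_indic.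
  have [Ex|nEx] := pselect (E x); last first.
    rewrite (hg x).2// indicE memNset//.
    have -> : (fun n => f n x * 0%:R) = cst 0 by apply/funext => n; rewrite mulr0.
    exact: cvg_cst.
  rewrite indicE mem_set//; under eq_fun do rewrite mulr1.
  have z : (2 * Num.sqrt (fine (S x)) * 2^-1 ^+ n : R) @[n --> \oo] --> (0 : R).
    by apply: (@cvg_geometric R); rewrite ger0_norm; lra.
  apply/cvgrPdist_le => e e0; apply: filterS (cvgr_le 0 z _ e0) => n.
  by apply: le_trans; rewrite distrC; exact: (hg x).1.
exists g => //; exists (4 * (C * (1 - 4^-1)^-1)) => n.
have c0 : 0 <= 4 * 4^-1 ^+ n :> R by rewrite mulr_ge0 ?exprn_ge0 ?invr_ge0.
apply: (@le_trans _ _ (\int[mu]_x ((4 * 4^-1 ^+ n)%:E * S x))%E).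
  apply: ge0_le_integral => //.
  - by move=> x _; rewrite lee_fin sqr_ge0.
  - by apply/measurable_EFinP/measurable_funX; exact: measurable_funB.
  - apply: emeasurable_funM => //; exact: measurable_cst.
  move=> x _; have [Ex|nEx] := pselect (E x); last first.
    have -> : S x = +oo%E.
      by move: nEx (S0 x); rewrite /E/=; case: (S x) => // r /(_ isT).
    by rewrite gt0_muley ?leey// lte_fin mulr_gt0// exprn_gt0// invr_gt0.
  rewrite (SE _ Ex) lee_fin -real_normK ?num_real//.
  have r0 : 0 <= 2 * Num.sqrt (fine (S x)) * 2^-1 ^+ n.
    by rewrite !mulr_ge0 ?sqrtr_ge0 ?exprn_ge0 ?invr_ge0.
  rewrite (le_trans (lerXn2r 2 _ _ ((hg x).1 Ex n))) ?nnegrE//.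
  rewrite !exprMn sqr_sqrtr ?fine_ge0// -exprM mulnC exprM.
  have -> : 2^-1 ^+ 2 = 4^-1 :> R by field.
  by rewrite mulrAC -natrX.
rewrite ge0_integralZl// (le_trans (lee_wpmul2l _ IS)) ?lee_fin//.
by rewrite mulrAC.
Qed.

Local Open Scope quotient_scope.

Lemma L2_sqnorm_pi (f : sqfun mu) :
  (sqnorm (L2_dot mu) (\pi_(L2 mu) f))%:E =
  (\int[mu]_x (rnorm (f x : R[i]) ^+ 2)%:E)%E.
Proof.
have /sqintP[mf If] := sqfunP f.
rewrite /sqnorm [X in complex.Re X](L2_dot_pi f f) /= /Rintegral.
rewrite -[RHS]fineK; last exact: integrable_fin_num.
congr (fine _)%:E; apply: eq_integral => x _.
by rewrite Re_mul Defs.Re_conj Defs.Im_conj rnorm2E mulrN opprK !expr2.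
Qed.

Lemma L2_complete : dot_complete (L2_dot mu).
Proof.
move=> u C uC; pose f n : sqfun mu := repr (u n).
have fE n : u n = \pi_(L2 mu) (f n) by rewrite reprK.
have mf n : cmeasurable (f n) by have /sqintP[] := sqfunP (f n).
have piB (g h : sqfun mu) : \pi_(L2 mu) g - \pi_(L2 mu) h = \pi_(L2 mu) (g - h).
  by apply/eqP; rewrite subr_eq -L2_piD subrK.
have fC n : (\int[mu]_x (rnorm (f n.+1 x - f n x : R[i]) ^+ 2)%:E <=
    (C * 16^-1 ^+ n)%:E)%E.
  by have := uC n; rewrite !fE piB -lee_fin L2_sqnorm_pi.
have mR n : measurable_fun setT (fun x => complex.Re (f n x)) := (mf n).1.
have mI n : measurable_fun setT (fun x => complex.Im (f n x)) := (mf n).2.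
have rnormB (z w : R[i]) : rnorm (z - w) ^+ 2 =
    (complex.Re z - complex.Re w) ^+ 2 + (complex.Im z - complex.Im w) ^+ 2.
  by rewrite rnorm2E; case: z w => [? ?] [? ?].
have msq (a b : X -> R) : measurable_fun setT a -> measurable_fun setT b ->
    measurable_fun setT (fun x => ((a x - b x) ^+ 2)%:E).
  by move=> ma mb; apply/measurable_EFinP/measurable_funX; exact: measurable_funB.
have mrn n : measurable_fun setT
    (fun x => (rnorm (f n.+1 x - f n x : R[i]) ^+ 2)%:E).
  by under eq_fun do rewrite rnormB EFinD; apply: emeasurable_funD; exact: msq.
have [n|g1 mg1 [D1 hD1]] := @fast_Cauchy_ae_limit _ C mR.
  apply: le_trans (fC n); apply: ge0_le_integral => //; last 2 first.
  - exact: msq.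
  - by move=> x _; rewrite lee_fin rnormB lerDl sqr_ge0.
  - by move=> x _; rewrite lee_fin sqr_ge0.
have [n|g2 mg2 [D2 hD2]] := @fast_Cauchy_ae_limit _ C mI.
  apply: le_trans (fC n); apply: ge0_le_integral => //; last 2 first.
  - exact: msq.
  - by move=> x _; rewrite lee_fin rnormB lerDr sqr_ge0.
  - by move=> x _; rewrite lee_fin sqr_ge0.
pose g x := g1 x +i* g2 x.
have fg n : (\int[mu]_x (rnorm (f n x - g x : R[i]) ^+ 2)%:E <=
    ((D1 + D2) * 4^-1 ^+ n)%:E)%E.
  under eq_integral do rewrite rnormB EFinD.
  rewrite ge0_integralD//; [|by move=> *; rewrite lee_fin sqr_ge0|exact: msq|
    by move=> *; rewrite lee_fin sqr_ge0|exact: msq].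
  by rewrite mulrDl EFinD leeD// ?hD1 ?hD2.
have cg : cmeasurable g by [].
have gL2 : g \in sqint mu.
  have -> : g = (f 0%N : X -> R[i]) - ((f 0%N : X -> R[i]) - g).
    by rewrite opprB addrC subrK.
  rewrite rpredB ?sqfunP//; apply/asboolP; split.
    have cN1 : cmeasurable ((fun=> -1) : X -> R[i]) := cmeasurable_cst _ _.
    have := cmeasurableD (mf 0%N) (cmeasurableM cN1 cg); congr cmeasurable.
    by apply/funext => x; rewrite mulN1r.
  by apply: le_lt_trans (fg 0%N) _; rewrite ltry.
exists (\pi_(L2 mu) (Sqfun gL2)).
apply/cvgr0Pnorm_le => e e0.
have z : ((D1 + D2) * 4^-1 ^+ n : R) @[n --> \oo] --> (0 : R).
  by apply: (@cvg_geometric R); rewrite ger0_norm; lra.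
apply: filterS (cvgr_le 0 z _ e0) => n; apply: le_trans.
rewrite ger0_norm ?sqnorm_ge0// fE piB -lee_fin L2_sqnorm_pi; exact: fg.
Qed.

End L2_complete.

(** * Polynomials approximating half-lines *)

Section steep_power.
Context (R : realType).

Lemma bernoulli_ineq (x : R) n : -1 <= x -> 1 + n%:R * x <= (1 + x) ^+ n.
Proof.
move=> x1; elim: n => [|n IH]; first by rewrite mul0r addr0 expr0.
have h : (1 + x) * (1 + n%:R * x) <= (1 + x) ^+ n.+1.
  by rewrite exprS ler_wpM2l//; lra.
apply: le_trans h; rewrite -natr1.
have : 0 <= n%:R * (x * x) by rewrite mulr_ge0// -expr2 sqr_ge0.
by move: (n%:R : R) => k; lra.
Qed.

(** With w = sqrt z, the term is (n w^n) w^n, and n w^n is bounded by Bernoulli's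
    inequality for 1/w. *)
Lemma cvg_natM_expr (z : R) : 0 <= z -> z < 1 ->
  n%:R * z ^+ n @[n --> \oo] --> (0 : R).
Proof.
move=> z0 z1; have [->|zN0] := eqVneq z 0.
  apply/cvgrPdist_le => e e0; exists 1%N => // n /= n0.
  by rewrite expr0n gtn_eqF// mulr0 subrr normr0 ltW.
have {zN0}z0 : 0 < z by rewrite lt_neqAle eq_sym zN0.
pose w := Num.sqrt z; have w0 : 0 < w by rewrite sqrtr_gt0.
have w1 : w < 1 by rewrite -sqrtr1 ltr_sqrt.
pose h := w^-1 - 1; have h0 : 0 < h by rewrite subr_gt0 invf_gt1.
have lim0 : h^-1 * w ^+ n @[n --> \oo] --> (0 : R).
  by apply: (@cvg_geometric R); rewrite ger0_norm// ltW.
apply: (squeeze_cvgr _ (cvg_cst 0) lim0); apply: nearW => n.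
rewrite mulr_ge0 ?exprn_ge0 ?(ltW z0)//=.
have -> : z = w * w by rewrite -expr2 sqr_sqrtr// ltW.
rewrite exprMn mulrA ler_wpM2r ?exprn_ge0 ?(ltW w0)//.
rewrite -[X in _ <= X]mul1r ler_pdivlMr// mulrAC -ler_pdivlMr ?exprn_gt0// mul1r.
rewrite -exprVn; have := @bernoulli_ineq h n; rewrite /h addrCA subrr addr0.
have -> : -1 <= w^-1 - 1 by rewrite lerBrDr addNr invr_ge0 ltW.
by move=> /(_ isT); apply: le_trans; rewrite lerDr.
Qed.

(** The exponent n 2^n makes the switch sharp at t = 1/2: the product
    n 2^n t^n tends to 0 below 1/2 and is at least n from 1/2 on. *)
Definition steep n (t : R) : R := (1 - t ^+ n) ^+ (n * 2 ^ n).

Lemma steep_ge0 n t : 0 <= t <= 1 -> 0 <= steep n t.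
Proof. by move=> /andP[t0 t1]; rewrite exprn_ge0// subr_ge0 exprn_ile1. Qed.

Lemma steep_le1 n t : 0 <= t <= 1 -> steep n t <= 1.
Proof.
move=> /andP[t0 t1]; rewrite exprn_ile1// ?subr_ge0 ?exprn_ile1//.
by rewrite gerBl exprn_ge0.
Qed.

Lemma steep_cvg1 t : 0 <= t < 2^-1 -> steep n t @[n --> \oo] --> (1 : R).
Proof.
move=> /andP[t0 t2]; have t1 : t <= 1 by lra.
have lim1 : 1 - n%:R * (2 * t) ^+ n @[n --> \oo] --> (1 - 0 : R).
  apply: cvgB; first exact: cvg_cst.
  by apply: cvg_natM_expr; lra.
rewrite subr0 in lim1.
apply: (squeeze_cvgr _ lim1 (cvg_cst (1 : R))); apply: nearW => n.
rewrite steep_le1 ?t0// andbT /steep.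
have := @bernoulli_ineq (- t ^+ n) (n * 2 ^ n).
rewrite lerN2 exprn_ile1// => /(_ isT); apply: le_trans.
by rewrite mulrN natrM natrX exprMn mulrA.
Qed.

(** Since 1 - x <= 1 / (1 + x), Bernoulli's inequality for (1 + x)^N bounds the
    value by 1 / (1 + N x) with N x >= n. *)
Lemma steep_cvg0 t : 2^-1 <= t <= 1 -> steep n t @[n --> \oo] --> (0 : R).
Proof.
move=> /andP[t2 t1]; have t0 : 0 <= t by lra.
apply: (squeeze_cvgr _ (cvg_cst 0) (@cvg_harmonic R)); apply: nearW => n.
rewrite steep_ge0 ?t0//= /steep; set x := t ^+ n; set N := (n * 2 ^ n)%N.
have x0 : 0 <= x by rewrite exprn_ge0.
have x1 : x <= 1 by rewrite exprn_ile1.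
rewrite -[X in _ <= X]mul1r ler_pdivlMr ?ltr0n//.
apply: (@le_trans _ _ ((1 - x) ^+ N * (1 + x) ^+ N)).
  apply: ler_wpM2l; first by rewrite exprn_ge0// subr_ge0.
  apply: le_trans (bernoulli_ineq N _); last by lra.
  rewrite -natr1 addrC lerD2l natrM natrX -mulrA ler_peMr// /x -exprMn.
  by rewrite exprn_ege1//; lra.
rewrite -exprMn exprn_ile1//; first by rewrite mulr_ge0; lra.
by have := sqr_ge0 x; rewrite expr2; lra.
Qed.

End steep_power.

(** * Functions determined by their moments *)

Section moments_determine.
Context d (X : measurableType d) (R : realType).
Variable mu : {finite_measure set X -> \bar R}.
Variables (rho g : X -> R) (M : R).
Hypothesis mrho : measurable_fun setT rho.
Hypothesis ig : mu.-integrable setT (EFin \o g).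
Hypothesis rhoM : {ae mu, forall x, `|rho x| <= M}.
Hypothesis moments : forall p : {poly R},
  (\int[mu]_x (g x * p.[rho x])%:E = 0)%E.

Lemma measurable_horner_comp (p : {poly R}) :
  measurable_fun setT (fun x => p.[rho x]).
Proof.
apply: (measurableT_comp _ mrho).
apply: continuous_measurable_fun; exact: continuous_horner.
Qed.

(** The affine map t sends the interval [-L + a, L + a], which contains the
    essential range of rho, to [0, 1] and a to 1/2; so the polynomials
    steep n (t s) converge boundedly to the indicator of s < a. *)
Lemma moments_ray (a : R) : (\int[mu]_(x in rho @^-1` `]-oo, a[) (g x)%:E = 0)%E.
Proof.
pose L := `|M| + `|a| + 1.
have L0 : 0 < L by rewrite ltr_wpDl// addr_ge0.
pose q : {poly R} := (2 * L)^-1 *: ('X - a%:P) + (2^-1)%:P.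
pose t s : R := (2 * L)^-1 * (s - a) + 2^-1.
pose p n : {poly R} := (1 - q ^+ n) ^+ (n * 2 ^ n).
have pE n s : (p n).[s] = steep n (t s).
  by rewrite /p /q /steep !hornerE/=.
have t01 x : `|rho x| <= M -> 0 <= t (rho x) <= 1.
  move=> xM; have h : `|(2 * L)^-1 * (rho x - a)| <= 2^-1.
    rewrite normrM gtr0_norm ?invr_gt0 ?mulr_gt0// mulrC ler_pdivrMr ?mulr_gt0//.
    rewrite mulKf// (le_trans (ler_normB _ _))// /L.
    by have := ler_norm M; lra.
  by move: h; rewrite ler_norml /t => /andP[? ?]; apply/andP; split; lra.
have t_lt s : (t s < 2^-1) = (s < a).
  by rewrite /t gtrDr pmulr_rlt0 ?invr_gt0 ?mulr_gt0// subr_lt0.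
have mA : measurable (rho @^-1` `]-oo, a[).
  by rewrite -[X in measurable X]setTI; exact: mrho.
pose A := rho @^-1` `]-oo, a[.
have mg : measurable_fun setT g by apply/measurable_EFinP/(measurable_int mu).
have pr1 n : measurable_fun setT (fun x => (g x * (p n).[rho x])%:E).
  by apply/measurable_EFinP/measurable_funM => //; exact: measurable_horner_comp.
have pr2 : measurable_fun setT (fun x => (g x * \1_A x)%:E).
  by apply/measurable_EFinP/measurable_funM => //; exact: measurable_indic.
have pr3 : {ae mu, forall x, setT x ->
    (fun n => (g x * (p n).[rho x])%:E) @ \oo --> (g x * \1_A x)%:E}.
  apply: filterS rhoM => x /t01 /andP[t0 t1] _.
  apply: cvg_EFin; first exact: nearW.
  apply: (@cvgM _ _ _ _ (cst (g x)) (fun n => (p n).[rho x])).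
    exact: cvg_cst.
  under eq_fun do rewrite pE.
  rewrite indicE; have [xa|ax] := ltP (rho x) a.
    rewrite mem_set /A/= ?in_itv//=; apply: steep_cvg1.
    by rewrite t0 t_lt.
  rewrite memNset /A/= ?in_itv/= ?ltNge ?ax//; apply: steep_cvg0.
  by rewrite t1 leNgt t_lt -leNgt ax.
have pr4 : mu.-integrable setT (fun x => `|(g x)%:E|%E) by exact: integrable_abse.
have pr5 : {ae mu, forall x n, setT x ->
    (`|(g x * (p n).[rho x])%:E| <= `|(g x)%:E|)%E}.
  apply: filterS rhoM => x /t01 xt n _.
  rewrite lee_fin normrM ler_piMr// pE ger0_norm ?steep_ge0 ?steep_le1//.
have [_ _] := @dominated_convergence _ _ _ mu setT measurableT
  (fun n x => (g x * (p n).[rho x])%:E) (fun x => (g x * \1_A x)%:E)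
  (fun x => `|(g x)%:E|%E) pr1 pr2 pr3 pr4 pr5.
rewrite /=.
under eq_fun do rewrite moments.
move=> hc; have h : (\int[mu]_x (g x * \1_A x)%:E = 0)%E.
  exact: (cvg_unique (@ereal_hausdorff R) hc (cvg_cst 0%E)).
rewrite integral_mkcond -[RHS]h; apply: eq_integral => x _.
by rewrite /restrict /patch indicE; case: ifPn; rewrite ?mulr1 ?mulr0.
Qed.

Lemma moments_preimage (B : set R) : measurable B ->
  (\int[mu]_(x in rho @^-1` B) (g x)%:E = 0)%E.
Proof.
have mg : measurable_fun setT (EFin \o g) := measurable_int mu ig.
have mpre S : measurable S -> measurable (rho @^-1` S).
  by move=> mS; rewrite -[X in measurable X]setTI; exact: mrho.
have T0 : (\int[mu]_x (g x)%:E = 0)%E.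
  rewrite -(moments 1); apply: eq_integral => x _.
  by rewrite hornerE mulr1.
have GE : @measurable _ (measurableTypeR R) = <<s @RGenInftyO.G R >>.
  exact: RGenInftyO.measurableE.
move=> mB; apply: (@dynkin_induction _ (measurableTypeR R) (@RGenInftyO.G R)
  (fun B => (\int[mu]_(x in rho @^-1` B) (g x)%:E = 0)%E)).
- exact: GE.
- move=> _ _ [a ->] [b ->]; exists (Num.min a b).
  by apply/seteqP; split => x /=; rewrite !in_itv/= lt_min => /andP.
- by rewrite preimage_setT.
- by move=> _ [a ->]; exact: moments_ray.
- move=> S mS S0; have := T0.
  rewrite -(setvU (rho @^-1` S)) integral_setU ?S0 ?adde0//.
  + exact/measurableC/mpre.
  + exact: mpre.
  + by rewrite setvU.
  + by rewrite disj_set2E setICl.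
- move=> F mF tF F0; rewrite preimage_bigcup integral_bigcup.
  + by under eq_eseriesr do rewrite F0; rewrite eseries0.
  + by move=> i j _ _ [x [Fi Fj]]; apply: (tF i j) => //; exists (rho x).
  + by move=> k; exact: mpre (mF k).
  + apply: integrableS ig => //; apply: bigcupT_measurable => k.
    exact: mpre (mF k).
- by rewrite -GE.
Qed.

Hypothesis rho_inj : forall A, measurable A -> exists2 B : set R,
  measurable B & {ae mu, forall x, A x <-> B (rho x)}.

(** When every measurable set is, up to a null set, the preimage of a Borel set
    under rho, moments_preimage makes all set integrals of g vanish. *)
Lemma moments_ae_eq0 : {ae mu, forall x, g x = 0}.
Proof.
have mg : measurable_fun setT (EFin \o g) := measurable_int mu ig.
have := @integral_ae_eq _ _ _ mu setT measurableT (cst 0%E) (EFin \o g) ig.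
move=> /(_ (measurable_cst _)) h.
have : ae_eq mu setT (EFin \o g) (cst 0%E).
  apply: h => E _ mE; rewrite integral0.
  have [B mB EB] := rho_inj mE.
  rewrite -(moments_preimage mB) [LHS]integral_mkcond [RHS]integral_mkcond.
  have mB' : measurable (rho @^-1` B).
    by rewrite -[X in measurable X]setTI; exact: mrho.
  apply: ae_eq_integral => //.
  - by apply/(measurable_restrictT _ mE); exact: measurable_funTS.
  - by apply/(measurable_restrictT _ mB'); exact: measurable_funTS.
  apply: filterS EB => x EBx _; rewrite /restrict.
  by congr (if _ then _ else _); apply/idP/idP; rewrite !inE => /EBx.
by apply: filterS => x /(_ I) [].
Qed.

End moments_determine.

(** * Borel structure of the complex plane *)

Section complex_borel.
Context (R : realType).

(** Stated for additive functions so as to treat real and imaginary parts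
    together. *)
Lemma open_real_part (h : {additive R[i] -> R}) (a : R) :
  (forall z, `|h z|%:C <= `|z|) -> @open (Cplx R) [set z | h z < a].
Proof.
move=> hle; rewrite openE => z /= za.
apply/nbhs_ballP; exists (a - h z)%:C; first by rewrite /= ltcR subr_gt0.
move=> w; rewrite -ball_normE/= distrC => /(le_lt_trans (hle _)).
rewrite ltcR raddfB => /(le_lt_trans (ler_norm _)).
by rewrite ltrBlDr subrK.
Qed.

Lemma measurable_real_part (h : {additive R[i] -> R}) :
  (forall z, `|h z|%:C <= `|z|) -> measurable_fun setT (h : borelC R -> R).
Proof.
move=> hle; apply: (measurability (@RGenInftyO.G R)).
  exact: RGenInftyO.measurableE.
move=> _ [_ [a ->] <-]; rewrite setTI; apply: sub_sigma_algebra.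
have -> : h @^-1` `]-oo, a[ = [set z | h z < a].
  by apply/seteqP; split => z /=; rewrite in_itv.
exact: open_real_part.
Qed.

Lemma measurable_Re : measurable_fun setT (@complex.Re R : borelC R -> R).
Proof.
apply: (@measurable_real_part (@complex.Re R)) => z; exact: normc_ge_Re.
Qed.

Lemma measurable_Im : measurable_fun setT (@complex.Im R : borelC R -> R).
Proof.
apply: (@measurable_real_part (@complex.Im R)) => z.
have i1 : `|'i%C : R[i]| = 1.
  by rewrite normc_def/= expr0n/= add0r expr1n sqrtr1.
by have := normc_ge_Re (z * 'i%C); rewrite ReiNIm normrN normrM i1 mulr1.
Qed.

Lemma measurable_real_complex :
  measurable_fun setT ((fun t => t%:C) : measurableTypeR R -> borelC R).
Proof.
apply: (@measurability _ _ (measurableTypeR R) (borelC R) setT _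
  (@open (Cplx R))).
  by [].
move=> _ [U oU <-]; rewrite setTI.
apply: open_measurable; rewrite openE => t /= Ut.
move: oU; rewrite openE => /(_ _ Ut)/nbhs_ballP[e /= e0 eU].
have eE : e = (complex.Re e)%:C.
  by apply/eqP; rewrite eq_complex/= eqxx/=; apply/eqP/ger0_Im/ltW.
apply/nbhs_ballP; exists (complex.Re e); first by rewrite /= -ltcR -eE.
move=> s; rewrite -ball_normE/= => ts; apply: eU.
rewrite -ball_normE/= eE -rmorphB normc_def/= expr0n addr0 sqrtr_sqr ltcR.
exact: ts.
Qed.

Lemma closed_measurableC (F : set (Cplx R)) :
  @closed (Cplx R) F -> measurable (F : set (borelC R)).
Proof.
move=> cF; rewrite -[F]setCK; apply: measurableC; apply: sub_sigma_algebra.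
exact: closed_openC.
Qed.

Lemma cmeasurable_horner (p : {poly R[i]}) :
  cmeasurable (fun z : borelC R => p.[z : R[i]]).
Proof.
elim/poly_ind: p => [|p c IH].
  have := cmeasurable_cst (borelC R) (0 : R[i]); congr cmeasurable.
  by apply/funext => z; rewrite horner0.
have hid : cmeasurable (fun z : borelC R => z : R[i]).
  by split; [exact: measurable_Re|exact: measurable_Im].
have := cmeasurableD (cmeasurableM IH hid) (cmeasurable_cst (borelC R) c).
by congr cmeasurable; apply/funext => z; rewrite hornerMXaddC.
Qed.

Lemma rnorm_sqM (z w : R[i]) : rnorm (z * w) ^+ 2 = rnorm z ^+ 2 * rnorm w ^+ 2.
Proof. by rewrite !rnorm2E; case: z w => [? ?] [? ?] /=; ring. Qed.

Lemma rnorm_sqD_le (z w : R[i]) :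
  rnorm (z + w) ^+ 2 <= 2 * (rnorm z ^+ 2 + rnorm w ^+ 2).
Proof.
rewrite !rnorm2E; case: z w => [a b] [c e] /=.
have := sqr_ge0 (a - c); have := sqr_ge0 (b - e).
by rewrite !expr2; lra.
Qed.

Lemma horner_bounded (p : {poly R[i]}) (M : R) : exists K : R, forall z : R[i],
  rnorm z ^+ 2 <= M -> rnorm p.[z] ^+ 2 <= K.
Proof.
elim/poly_ind: p => [|p c [K hK]].
  by exists 0 => z _; rewrite horner0 rnorm2E/= expr0n addr0.
exists (2 * (K * M + rnorm c ^+ 2)) => z zM.
rewrite hornerMXaddC (le_trans (rnorm_sqD_le _ _))// ler_wpM2l// lerD2r.
by rewrite rnorm_sqM ler_pM ?sqr_ge0 ?hK.
Qed.

End complex_borel.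

(** * Density of polynomials in L2 *)

Section polynomials_in_L2.
Context (R : realType) (mu : {finite_measure set (borelC R) -> \bar R}) (M : R).
Hypothesis ae_real : {ae mu, forall z : borelC R, complex.Im z = 0}.
Hypothesis ae_bounded : {ae mu, forall z : borelC R, `|complex.Re z| <= M}.

Local Open Scope quotient_scope.

Lemma cintegral_ae_setT (D : set (borelC R)) (f g : borelC R -> R[i]) :
  measurable D -> {ae mu, forall z, D z} -> cmeasurable f -> cmeasurable g ->
  {ae mu, forall z, f z = g z} -> cintegral mu D f = cintegral mu setT g.
Proof.
move=> mD aeD [f1 f2] [g1 g2] fg; rewrite /cintegral /Rintegral.
have E (h : R[i] -> R) :
    measurable_fun setT (h \o f) -> measurable_fun setT (h \o g) ->
    (\int[mu]_(z in D) (h (f z))%:E = \int[mu]_z (h (g z))%:E)%E.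
  move=> hf hg; rewrite integral_mkcond; apply: ae_eq_integral => //.
  - by apply/(measurable_restrictT _ mD)/measurable_funTS/measurable_EFinP.
  - exact/measurable_EFinP.
  apply: filterS2 aeD fg => z Dz fgz _.
  by rewrite /restrict /patch mem_set//= fgz.
by congr (fine _ +i* fine _); exact: E.
Qed.

Lemma ae_rnorm_bounded :
  {ae mu, forall z : borelC R, rnorm (z : R[i]) ^+ 2 <= M ^+ 2}.
Proof.
apply: filterS2 ae_real ae_bounded => z z0 zM.
rewrite rnorm2E z0 expr0n addr0 -real_normK ?num_real//.
by rewrite ler_pXn2r// nnegrE (le_trans _ zM).
Qed.

Lemma sqint_bounded_mul (f g : borelC R -> R[i]) (K : R) : cmeasurable f ->
  {ae mu, forall z, rnorm (f z) ^+ 2 <= K} -> g \in sqint mu ->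
  (fun z => f z * g z) \in sqint mu.
Proof.
move=> mf fK /asboolP[mg Ig]; apply/asboolP.
have mfg : cmeasurable (fun z => f z * g z) by exact: cmeasurableM.
split => //.
apply: (@le_lt_trans _ _ (\int[mu]_z (`|K|%:E * (rnorm (g z) ^+ 2)%:E))%E).
  apply: ae_ge0_le_integral => //.
  - by move=> z _; rewrite lee_fin sqr_ge0.
  - by apply/measurable_EFinP/measurable_rnorm2.
  - by move=> z _; rewrite mule_ge0// lee_fin sqr_ge0.
  - by apply/measurable_EFinP/measurable_funM => //; exact: measurable_rnorm2.
  apply: filterS fK => z zK _.
  by rewrite rnorm_sqM lee_fin ler_wpM2r ?sqr_ge0// (le_trans zK)// ler_norm.
rewrite ge0_integralZl//; last 2 first.
- by apply/measurable_EFinP/measurable_rnorm2.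
- by move=> z _; rewrite lee_fin sqr_ge0.
by rewrite lte_mul_pinfty// lee_fin.
Qed.

Lemma sqint_one : (fun=> 1 : R[i]) \in sqint mu.
Proof.
apply/asboolP; split; first exact: cmeasurable_cst.
rewrite (_ : (fun _ => _) = cst 1%E).
  by rewrite integral_cst//= mul1e; exact: fin_num_fun_lty.
by apply/funext => z; rewrite rnorm2E/= expr1n expr0n addr0.
Qed.

Lemma sqint_horner (p : {poly R[i]}) :
  (fun z : borelC R => p.[z : R[i]]) \in sqint mu.
Proof.
have [K hK] := horner_bounded p (M ^+ 2).
have -> : (fun z : borelC R => p.[z : R[i]]) = (fun z => p.[z] * 1).
  by apply/funext => z; rewrite mulr1.
apply: (@sqint_bounded_mul _ _ K (cmeasurable_horner p) _ sqint_one).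
by apply: filterS ae_rnorm_bounded => z; exact: hK.
Qed.

Definition polyL2_class (p : {poly R[i]}) : L2 mu :=
  \pi_(L2 mu) (Sqfun (sqint_horner p)).

Lemma polyL2_class_linear : linear polyL2_class.
Proof.
move=> c p q; rewrite /polyL2_class.
have -> (f : sqfun mu) : c *: (\pi_(L2 mu) f : L2 mu) = \pi_(L2 mu) (c *: f).
  exact: L2_scale_pi.
rewrite -L2_piD; apply/pi_ae; apply: aeW => z.
by rewrite /= hornerD hornerZ.
Qed.

Definition polyL2 : {linear {poly R[i]} -> L2 mu} :=
  HB.pack_for {linear {poly R[i]} -> L2 mu} polyL2_class
    (GRing.isLinear.Build _ _ _ _ polyL2_class polyL2_class_linear).

Lemma dot_polyL2 (f : sqfun mu) p : L2_dot mu (\pi_(L2 mu) f) (polyL2 p) =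
  cintegral mu setT (fun z => f z * (p.[z : R[i]])^*%C).
Proof. exact: L2_dot_pi. Qed.

Lemma mulz_sqint (f : sqfun mu) :
  (fun z : borelC R => (z : R[i]) * f z) \in sqint mu.
Proof.
apply: (@sqint_bounded_mul _ _ (M ^+ 2)); [|exact: ae_rnorm_bounded|exact: sqfunP].
by split; [exact: measurable_Re|exact: measurable_Im].
Qed.

(** Real and imaginary parts are treated separately, as h = Re and h = Im.  On
    the real line the conjugate of a real polynomial is itself, so h (f z) is
    orthogonal to all real polynomials in Re z; and a Borel set of the plane
    agrees almost everywhere with a condition on Re z. *)
Lemma polyL2_total : dot_total (L2_dot mu) polyL2.
Proof.
move=> u; elim/L2_ind: u => f f0.
have /sqintP[mf _] := sqfunP f.
have key (h : {additive R[i] -> R}) : (forall z r, h (z * r%:C) = h z * r) ->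
    measurable_fun setT (h \o f) ->
    (forall p, mu.-integrable setT
      (fun z => (h (f z * (p.[z : R[i]])^*%C))%:E)) ->
    (forall p, (\int[mu]_z (h (f z * (p.[z : R[i]])^*%C))%:E = 0)%E) ->
    {ae mu, forall z, h (f z) = 0}.
  move=> hr mh hint h0.
  have ae1 : {ae mu, forall z, forall q : {poly R},
      h (f z) * q.[complex.Re z] =
      h (f z * (map_poly (real_complex R) q).[z : R[i]]^*%C)}.
    apply: filterS ae_real => z z0 q.
    have zE : z = (complex.Re z)%:C by case: z z0 => a b /= ->.
    have -> : (map_poly (real_complex R) q).[z : R[i]] = (q.[complex.Re z])%:C.
      by rewrite [X in _.[X]]zE horner_map.
    by rewrite conjc_real hr.
  have mq (q : {poly R}) : measurable_fun setT
      (fun z : borelC R => (h (f z) * q.[complex.Re z])%:E).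
    apply/measurable_EFinP/measurable_funM => //.
    by apply: measurable_horner_comp; exact: measurable_Re.
  apply: (@moments_ae_eq0 _ _ _ mu (@complex.Re R) _ M) => //.
  - exact: measurable_Re.
  - have := hint 1; congr (mu.-integrable _ _); apply/funext => z /=.
    by rewrite hornerC conjc1 mulr1.
  - move=> q; rewrite -(h0 (map_poly (real_complex R) q)).
    apply: ae_eq_integral => //; first exact: (measurable_int mu (hint _)).
    by apply: filterS ae1 => z hz _; rewrite hz.
  - move=> A mA; exists ((fun t => t%:C) @^-1` A).
      by rewrite -[X in measurable X]setTI; exact: measurable_real_complex.
    apply: filterS ae_real => z z0 /=.
    by have <- : z = (complex.Re z)%:C by case: z z0 => a b /= ->.
have int p : cintegrable mu (fun z => f z * (p.[z : R[i]])^*%C).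
  exact: integrable_cmul (sqfunP f) (sqint_horner p).
have {}f0 p : cintegral mu setT (fun z => f z * (p.[z : R[i]])^*%C) = 0.
  by rewrite -dot_polyL2 f0.
have aeRe : {ae mu, forall z, complex.Re (f z) = 0}.
  apply: (key (@complex.Re R)) => [[a b] r|||] /=.
  - by rewrite mulr0 subr0.
  - exact: mf.1.
  - by move=> p; exact: (int p).1.
  - move=> p; rewrite -[LHS]fineK; last exact: integrable_fin_num (int p).1.
    by have /(congr1 (@complex.Re R)) := f0 p; rewrite /= /Rintegral => ->.
have aeIm : {ae mu, forall z, complex.Im (f z) = 0}.
  apply: (key (@complex.Im R)) => [[a b] r|||] /=.
  - by rewrite mulr0 add0r.
  - exact: mf.2.
  - by move=> p; exact: (int p).2.
  - move=> p; rewrite -[LHS]fineK; last exact: integrable_fin_num (int p).2.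
    by have /(congr1 (@complex.Im R)) := f0 p; rewrite /= /Rintegral => ->.
rewrite -(L2_pi0 mu); apply/pi_ae; apply: filterS2 aeRe aeIm => z.
by rewrite /=; case: (f z) => a b /= -> ->.
Qed.

End polynomials_in_L2.

(** * The spectral representation *)

(** A vector orthogonal to the orbit makes the sum in the lower frame bound
    vanish. *)
Lemma frame_poly_orbit_total (R : realType) (H : hilbertType R)
    (T : {linear H -> H}) (phi : H) :
  frame (fun k => iter k T phi) -> dot_total dotp (poly_orbit T phi).
Proof.
move=> [A [B [A0 _ hfr]]] h h0.
have [hA _] := andP (hfr h).
move: hA; rewrite eseries0; last first.
  move=> k _ _; have /= := h0 'X^k; rewrite poly_opXn => ->.
  by rewrite rnorm2E/= expr0n addr0.
rewrite lee_fin pmulr_rle0// => hle.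
apply: (sqnorm_eq0 (d := dotp)).
by rewrite sqnorm_dotp; apply/eqP; rewrite eq_le hle sqr_ge0.
Qed.

Theorem proposition2p1 (R : realType) (H : hilbertType R)
    (T : {linear H -> H}) (phi : H)
    (mu : {finite_measure set (borelC R) -> \bar R}) :
  separable H ->
  bounded_op T ->
  self_adjoint T ->
  frame (fun k => iter k T phi) ->
  spectral_measure T phi mu ->
  exists (V : {linear H -> L2 mu}) (Vs : {linear L2 mu -> H}),
    [/\ unitary dotp (L2_dot mu) V,
        adjoint dotp (L2_dot mu) V Vs &
        forall f : L2 mu, {ae mu, forall x : borelC R, spectrum T x ->
          L2_fun (V (T (Vs f))) x = (x : R[i]) * L2_fun f x}].
Proof.
move=> _ Tb Tsa fr smu.
have [M M0 hM] := spectrum_bounded Tb Tsa.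
have ae_sp (P : borelC R -> Prop) : (forall z, spectrum T z -> P z) ->
    {ae mu, forall z, P z}.
  by move=> TP; apply: negligibleS smu.1 => z; apply: contra_not; exact: TP.
have ae_re : {ae mu, forall z : borelC R, complex.Im z = 0}.
  by apply: ae_sp => z; exact: spectrum_real.
have ae_bd : {ae mu, forall z : borelC R, `|complex.Re z| <= M} by exact: ae_sp.
have ae_conj : {ae mu, forall z : borelC R, (z : R[i])^*%C = z}.
  by apply: filterS ae_re => -[a b] /= ->; rewrite oppr0.
pose b := polyL2 ae_re ae_bd.
have gram p q : dotp (poly_orbit T phi p) (poly_orbit T phi q) =
    L2_dot mu (b p) (b q).
  rewrite [RHS]dot_polyL2 /= (gram_poly_op _ _ _ smu)//.
  apply: cintegral_ae_setT => //.
  - exact: (closed_measurableC (spectrum_closed Tb Tsa)).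
  - exact: ae_sp.
  - by apply: cmeasurableM; exact: cmeasurable_horner.
  - by apply: cmeasurableM; [|apply: cmeasurableJ]; exact: cmeasurable_horner.
  apply: filterS ae_conj => z zE.
  by have /= := horner_map (@conjc R) q z; rewrite zE => ->.
have [V [Vs [Vu Vadj VsK Vab]]] := unitary_of_gram (@hilbert_complete R H)
  (@L2_complete _ _ R mu) (frame_poly_orbit_total fr)
  (@polyL2_total R mu M ae_re ae_bd) gram.
exists V, Vs; split => //; elim/L2_ind => f.
pose xf : sqfun mu := Sqfun (mulz_sqint ae_re ae_bd f).
suff -> : V (T (Vs (\pi_(L2 mu) f)%qT)) = (\pi_(L2 mu) xf)%qT.
  by apply: filterS2 (L2_fun_pi xf) (L2_fun_pi f) => z -> ->.
apply/eqP; rewrite -subr_eq0; apply/eqP.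
apply: (polyL2_total (ae_real := ae_re) (ae_bounded := ae_bd)) => q.
have e1 : L2_dot mu (V (T (Vs (\pi_(L2 mu) f)%qT))) (b q) =
    L2_dot mu (\pi_(L2 mu) f)%qT (b (q * 'X)).
  rewrite -(Vab q) -(Vab (q * 'X)) -[in RHS](VsK (\pi_(L2 mu) f)%qT).
  apply: (etrans (Vu.1 _ _)); apply: (etrans (Tsa _ _)).
  by rewrite /= -poly_opMX; apply: esym; exact: Vu.1.
have e2 : L2_dot mu (\pi_(L2 mu) xf)%qT (b q) =
    L2_dot mu (\pi_(L2 mu) f)%qT (b (q * 'X)).
  rewrite [LHS]dot_polyL2 [RHS]dot_polyL2.
  apply: cintegral_ae_setT => //; first exact: aeW.
  - apply: cmeasurableM; first by have /sqintP[] := sqfunP xf.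
    by apply: cmeasurableJ; exact: cmeasurable_horner.
  - apply: cmeasurableM; first by have /sqintP[] := sqfunP f.
    by apply: cmeasurableJ; exact: cmeasurable_horner.
  apply: filterS ae_conj => z zE.
  by rewrite /= hornerMX rmorphM/= zE; ring.
by rewrite dotBl [X in X - _]e1 [X in _ - X]e2 subrr.
Qed.
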